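(* Let $n,L\ge 1$, $\sigma\in B_n$, $\mu\in\{\pm1,\dots,\pm L\}^n$, and let $f_\mu^\sigma(\bm x)$ be the partition function of the colored stochastic vertex model with U-turn boundary defined in the context. Assume that $1\le i\le n-1$ and $\sigma(i+1)>\sigma(i)$ (in the ordering of signed colors given in the context). Let $s_i\in B_n$ be the transposition $(i,i+1)$, and let $s_i\bm x=(x_1,\dots,x_{i+1},x_i,\dots,x_n)$ be obtained from $\bm x=(x_1,\dots,x_n)$ by swapping $x_i$ and $x_{i+1}$. Then $$q^{1+\mathbf 1_{\sigma(i+1)\in[n]}}\,f_\mu^{\sigma s_i}(\bm x)=\frac{(q-1)x_{i+1}}{x_{i+1}-x_i}\,q^{\mathbf 1_{\sigma(i)\in[n]}}f_\mu^\sigma(\bm x)+\frac{x_{i+1}-qx_i}{x_{i+1}-x_i}\,q^{\mathbf 1_{\sigma(i)\in[n]}}f_\mu^\sigma(s_i\bm x).$$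
   Context: **Colors.** Fix integers $n,L\ge1$. The signed colors are $[\pm n]=\{1,\dots,n,\overline n,\dots,\overline 1\}$, with positive colors $[n]=\{1,\dots,n\}$ and negative colors $[\overline n]=\{\overline1,\dots,\overline n\}$; there is also a color $0$ (also written $+$). Ordering: $1<\cdots<n<0<\overline n<\cdots<\overline1$. Put $\overline{\overline i}=i$. $B_n$ is the group of permutations $\sigma$ of $[\pm n]$ with $\sigma(\overline i)=\overline{\sigma(i)}$; the product is composition, $(\sigma\tau)(k)=\sigma(\tau(k))$. The transposition $(i,i+1)\in B_n$ swaps $i,i+1$ and swaps $\overline i,\overline{i+1}$. $\mathbf 1_A$ denotes an indicator. **Vectors.** $\mathbb N=\{0,1,2,\dots\}$. Vectors $\bm I=(I_1,\dots,I_n,I_{\overline n},\dots,I_{\overline1})\in\mathbb N^{2n}$ are indexed by $[\pm n]$, with standard basis $\bm e_k$ ($k\in[\pm n]$), and $\bm e_0=0$. Put $\bm I_{[j,j']}=\sum_{k\in[\pm n],\,j\le k\le j'}I_k$, and similarly $\bm I_{<j},\bm I_{>j},\bm I_{\le j},\bm I_{\ge j}$ (sums over $k\in[\pm n]$); $\bm I_\ell=I_\ell$. **Parameters.** $q,\nu,t\in\mathbb C$, $s\in\mathbb C^*$, $\bm x=(x_1,\dots,x_n)$ complex spectral parameters, with a fixed square root $q^{1/2}$ of $q$. Parameters are assumed to be such that all denominators that occur are nonzero (in particular $q,\nu,x_i\neq0$); the identities are identities of rational functions. **$\Gamma$ weights.** $\mathcal L_x(\bm I,j,\bm K,\ell)$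 is for a vertex with bottom edge $\bm I$, left edge $j$, top edge $\bm K$, right edge $\ell$ ($j,\ell\in\{0\}\cup[\pm n]$, $\bm I,\bm K\in\mathbb N^{2n}$). It is $0$ unless $\bm I+\bm e_j=\bm K+\bm e_\ell$, in which case it equals: - $\ell=0$: $\frac{q^{-\bm I_{[1,n]}}-sxq^{\bm I_{[\overline n,\overline1]}}}{1-sx}$ if $j=\ell$; $\frac{xq^{-\bm I_{[1,n]}}-s^2xq^{\bm I_{[\overline n,\overline1]}}}{s(1-sx)}$ if $j<\ell$; $\frac{q^{-\bm I_{[1,n]}}-s^2q^{\bm I_{[\overline n,\overline1]}}}{1-sx}$ if $j>\ell$. - $\ell\in[n]$: $\frac{(sq^{\bm I_\ell}-x)q^{-\bm I_{\le\ell}}}{s(1-sx)}$ if $j=\ell$; $\frac{-x(1-q^{\bm I_\ell})q^{-\bm I_{\le\ell}}}{s(1-sx)}$ if $j<\ell$; $\frac{-(1-q^{\bm I_\ell})q^{-\bm I_{\le\ell}}}{1-sx}$ if $j>\ell$. - $\ell\in[\overline n]$: $\frac{s(sq^{\bm I_\ell}-x)q^{\bm I_{>\ell}}}{1-sx}$ if $j=\ell$; $\frac{-sx(1-q^{\bm I_\ell})q^{\bm I_{>\ell}}}{1-sx}$ if $j<\ell$; $\frac{-s^2(1-q^{\bm I_\ell})q^{\bm I_{>\ell}}}{1-sx}$ if $j>\ell$. **$\Delta$ weights.** $\mathcal M_x(\bm I,j,\bm K,\ell)$ is for a vertex with bottom edge $\bm I$, right edge $j$, top edge $\bm K$, left edge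 $\ell$. It is $0$ unless $\bm I+\bm e_j=\bm K+\bm e_\ell$, in which case it equals: - $\ell=0$: $\frac{q^{-\bm I_{[\overline n,\overline1]}}-sxq^{\bm I_{[1,n]}}}{1-sx}$ if $j=\ell$; $\frac{q^{-\bm I_{[\overline n,\overline1]}}-s^2q^{\bm I_{[1,n]}}}{1-sx}$ if $j<\ell$; $\frac{x(s^{-1}q^{-\bm I_{[\overline n,\overline1]}}-sq^{\bm I_{[1,n]}})}{1-sx}$ if $j>\ell$. - $\ell\in[n]$: $\frac{s(sq^{\bm I_\ell}-x)q^{\bm I_{<\ell}}}{1-sx}$ if $j=\ell$; $\frac{-s^2(1-q^{\bm I_\ell})q^{\bm I_{<\ell}}}{1-sx}$ if $j<\ell$; $\frac{-sx(1-q^{\bm I_\ell})q^{\bm I_{<\ell}}}{1-sx}$ if $j>\ell$. - $\ell\in[\overline n]$: $\frac{(1-s^{-1}xq^{-\bm I_\ell})q^{-\bm I_{>\ell}}}{1-sx}$ if $j=\ell$; $\frac{-(1-q^{\bm I_\ell})q^{-\bm I_{\ge\ell}}}{1-sx}$ if $j<\ell$; $\frac{-s^{-1}x(1-q^{\bm I_\ell})q^{-\bm I_{\ge\ell}}}{1-sx}$ if $j>\ell$. **Cap weights.** Let $\phi(x)=\frac{1-x^2}{(1-\nu tx)(1+\nu^{-1}x)}$. Let $\mathcal C_x(a,b)$ be the weight of a cap with bottom edge $a$ and top edge $b$: $\mathcal C_x(0,0)=1$, and for $i\in[n]$, $\mathcal C_x(i,\overline i)=t\phi(q^{-1/2}x^{-1})$,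 $\mathcal C_x(i,i)=1-t\phi(q^{-1/2}x^{-1})$, $\mathcal C_x(\overline i,i)=\phi(q^{-1/2}x^{-1})$, $\mathcal C_x(\overline i,\overline i)=1-\phi(q^{-1/2}x^{-1})$; all other values are $0$. **Model and partition function.** The lattice has $2n$ rows, labeled $1,\dots,2n$ from top to bottom, and $L$ columns, labeled $1,\dots,L$ from right to left. Even rows consist of $\Gamma$ vertices, odd rows of $\Delta$ vertices; rows $2i-1$ and $2i$ have spectral parameter $x_i$ and are joined on the right by a cap with parameter $x_i$. Given $\sigma\in B_n$ and $\mu\in\{\pm1,\dots,\pm L\}^n$, a state is an assignment of horizontal labels $h_{r,c}\in\{0\}\cup[\pm n]$ ($1\le r\le2n$, $0\le c\le L$) and vertical labels $V_{r,c}\in\mathbb N^{2n}$ ($0\le r\le2n$, $1\le c\le L$), where the vertex in row $r$ and column $c$ has left edge $h_{r,c}$, right edge $h_{r,c-1}$, bottom edge $V_{r,c}$, top edge $V_{r-1,c}$, with boundary conditions: $h_{2i-1,L}=0$ and $h_{2i,L}=\sigma(i)$ for $i\in[n]$; $V_{2n,c}=\bm e_0$ for all $c$; $V_{0,c}=\sum_{i=1}^n(\mathbf 1_{\mu_i=c}\bm e_i+\mathbf 1_{\mu_i=-c}\bm e_{\overline i})$. The partition function $f_\mu^\sigma(\bm x)$ is the sum over all states of $$\prod_{i=1}^n\Big(\mathcal C_{x_i}(h_{2i,0},h_{2i-1,0})\prod_{c=1}^L\mathcal L_{x_i}(V_{2i,c},h_{2i,c},V_{2i-1,c},h_{2i,c-1})\,\mathcal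 M_{x_i}(V_{2i-1,c},h_{2i-1,c-1},V_{2i-2,c},h_{2i-1,c})\Big).$$ Only finitely many states contribute. *)

(* Defs.v *)
From HB Require Import structures.
From mathcomp Require Import all_boot all_order all_fingroup all_algebra.
From mathcomp Require Import all_classical all_reals.
From mathcomp Require Import complex.

Set Implicit Arguments.
Unset Strict Implicit.
Unset Printing Implicit Defensive.

Import Order.TTheory GRing.Theory Num.Theory.
Local Open Scope ring_scope.

(* [inl i] is the positive color i+1, [inr i] the negative color bar(i+1);
   in [label n], [None] is the color 0. *)
Notation scolor n := ('I_n + 'I_n)%type.
Notation label n := (option (scolor n)).

Definition bar n (k : scolor n) : scolor n :=
  match k with inl i => inr i | inr i => inl i end.

Definition is_pos n (k : scolor n) : bool :=
  match k with inl _ => true | inr _ => false end.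

(* Position of a label in the list 1 < ... < n < 0 < bar n < ... < bar 1. *)
Definition rank n (a : label n) : nat :=
  match a with
  | Some (inl i) => i
  | None => n
  | Some (inr i) => (n.*2 - i)%N
  end.

Definition ltl n (a b : label n) : bool := (rank a < rank b)%N.
Definition lel n (a b : label n) : bool := (rank a <= rank b)%N.

Definition Bn n : {set {perm scolor n}} :=
  [set sg : {perm scolor n} | [forall k, sg (bar k) == bar (sg k)]].

(* (sg tau)(k) = sg (tau k); the product of [{perm _}] composes in the opposite
   order. *)
Definition bmul n (sg tau : {perm scolor n}) : {perm scolor n} := (tau * sg)%g.

(* The transposition swapping i, j and also bar i, bar j. *)
Definition btperm n (i j : 'I_n) : {perm scolor n} :=
  (tperm (inl i) (inl j) * tperm (inr i) (inr j))%g.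

Definition cvec n := {ffun scolor n -> nat}.

(* e_k, with e_0 = 0. *)
Definition evec n (a : label n) : cvec n :=
  [ffun k : scolor n => (a == Some k : nat)].

(* The sum of the entries of I whose color satisfies P. *)
Definition sumv n (I : cvec n) (P : pred (scolor n)) : nat :=
  (\sum_(k | P k) I k)%N.

Definition sum_pos n (I : cvec n) := sumv I (fun k => is_pos k).
Definition sum_neg n (I : cvec n) := sumv I (fun k => ~~ is_pos k).
Definition sum_lt n (I : cvec n) (l : scolor n) :=
  sumv I (fun k => ltl (Some k) (Some l)).
Definition sum_le n (I : cvec n) (l : scolor n) :=
  sumv I (fun k => lel (Some k) (Some l)).
Definition sum_gt n (I : cvec n) (l : scolor n) :=
  sumv I (fun k => ltl (Some l) (Some k)).
Definition sum_ge n (I : cvec n) (l : scolor n) :=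
  sumv I (fun k => lel (Some l) (Some k)).

(* I + e_j = K + e_l *)
Definition conserved n (I : cvec n) (j : label n) (K : cvec n) (l : label n)
  : bool :=
  [forall k, I k + evec j k == K k + evec l k]%N.

(* Gamma vertex: bottom I, left j, top K, right l. *)
Definition Lweight (F : fieldType) (q s : F) n (x : F)
    (I : cvec n) (j : label n) (K : cvec n) (l : label n) : F :=
  if ~~ conserved I j K l then 0 else
  match l with
  | None =>
      if j == l then
        (q ^- sum_pos I - s * x * q ^+ sum_neg I) / (1 - s * x)
      else if ltl j l then
        (x * q ^- sum_pos I - s ^+ 2 * x * q ^+ sum_neg I) / (s * (1 - s * x))
      else
        (q ^- sum_pos I - s ^+ 2 * q ^+ sum_neg I) / (1 - s * x)
  | Some (inl _ as k) =>
      if j == l then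
        (s * q ^+ I k - x) * q ^- sum_le I k / (s * (1 - s * x))
      else if ltl j l then
        - x * (1 - q ^+ I k) * q ^- sum_le I k / (s * (1 - s * x))
      else
        - (1 - q ^+ I k) * q ^- sum_le I k / (1 - s * x)
  | Some (inr _ as k) =>
      if j == l then
        s * (s * q ^+ I k - x) * q ^+ sum_gt I k / (1 - s * x)
      else if ltl j l then
        - s * x * (1 - q ^+ I k) * q ^+ sum_gt I k / (1 - s * x)
      else
        - s ^+ 2 * (1 - q ^+ I k) * q ^+ sum_gt I k / (1 - s * x)
  end.

(* Delta vertex: bottom I, right j, top K, left l. *)
Definition Mweight (F : fieldType) (q s : F) n (x : F)
    (I : cvec n) (j : label n) (K : cvec n) (l : label n) : F :=
  if ~~ conserved I j K l then 0 else
  match l with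
  | None =>
      if j == l then
        (q ^- sum_neg I - s * x * q ^+ sum_pos I) / (1 - s * x)
      else if ltl j l then
        (q ^- sum_neg I - s ^+ 2 * q ^+ sum_pos I) / (1 - s * x)
      else
        x * (s^-1 * q ^- sum_neg I - s * q ^+ sum_pos I) / (1 - s * x)
  | Some (inl _ as k) =>
      if j == l then
        s * (s * q ^+ I k - x) * q ^+ sum_lt I k / (1 - s * x)
      else if ltl j l then
        - s ^+ 2 * (1 - q ^+ I k) * q ^+ sum_lt I k / (1 - s * x)
      else
        - s * x * (1 - q ^+ I k) * q ^+ sum_lt I k / (1 - s * x)
  | Some (inr _ as k) =>
      if j == l then
        (1 - s^-1 * x * q ^- I k) * q ^- sum_gt I k / (1 - s * x)
      else if ltl j l then
        - (1 - q ^+ I k) * q ^- sum_ge I k / (1 - s * x)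
      else
        - s^-1 * x * (1 - q ^+ I k) * q ^- sum_ge I k / (1 - s * x)
  end.

Definition phi (F : fieldType) (nu t : F) (x : F) : F :=
  (1 - x ^+ 2) / ((1 - nu * t * x) * (1 + nu^-1 * x)).

(* Cap: bottom a, top b; [qh] is the chosen square root of q. *)
Definition Cweight (F : fieldType) (qh nu t : F) n (x : F) (a b : label n)
  : F :=
  let p := phi nu t (qh^-1 * x^-1) in
  match a, b with
  | None, None => 1
  | Some (inl i), Some (inr i') => if i == i' then t * p else 0
  | Some (inl i), Some (inl i') => if i == i' then 1 - t * p else 0
  | Some (inr i), Some (inl i') => if i == i' then p else 0
  | Some (inr i), Some (inr i') => if i == i' then 1 - p else 0
  | _, _ => 0
  end.

(* A pair (h, V).  Row r is represented by the ordinal r-1 in 'I_(n.*2) and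
   column c by the ordinal c-1 in 'I_L, while the edge coordinates (c in 0..L
   for h, r in 0..2n for V) are not shifted. *)
Definition state n L :=
  ({ffun 'I_n.*2 * 'I_L.+1 -> label n} *
   {ffun 'I_n.*2.+1 * 'I_L -> cvec n})%type.

Lemma delta_row_subproof n (i : 'I_n) : (i.*2 < n.*2)%N.
Proof. by rewrite ltn_double. Qed.

Lemma gamma_row_subproof n (i : 'I_n) : (i.*2.+1 < n.*2)%N.
Proof. by rewrite ltn_Sdouble. Qed.

(* The rows 2k-1 and 2k, for k = i+1. *)
Definition delta_row n (i : 'I_n) : 'I_n.*2 := Ordinal (delta_row_subproof i).
Definition gamma_row n (i : 'I_n) : 'I_n.*2 := Ordinal (gamma_row_subproof i).

Definition hedge n L (st : state n L) (r : 'I_n.*2) (c : 'I_L.+1) : label n :=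
  st.1 (r, c).
Definition vedge n L (st : state n L) (r : 'I_n.*2.+1) (c : 'I_L) : cvec n :=
  st.2 (r, c).

(* Edges around the vertex in row r, column c; columns increase leftwards. *)
Definition ledge n L (st : state n L) (r : 'I_n.*2) (c : 'I_L) : label n :=
  hedge st r (lift ord0 c).
Definition redge n L (st : state n L) (r : 'I_n.*2) (c : 'I_L) : label n :=
  hedge st r (widen_ord (leqnSn L) c).
Definition bedge n L (st : state n L) (r : 'I_n.*2) (c : 'I_L) : cvec n :=
  vedge st (lift ord0 r) c.
Definition tedge n L (st : state n L) (r : 'I_n.*2) (c : 'I_L) : cvec n :=
  vedge st (widen_ord (leqnSn n.*2) r) c.

Definition top_vec n (mu : 'I_n -> int) (c : nat) : cvec n :=
  [ffun k : scolor n => (\sum_(i < n)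
     ((mu i == c%:Z) * evec (Some (inl i)) k +
      (mu i == - c%:Z) * evec (Some (inr i)) k))%N].

Definition admissible n L (mu : 'I_n -> int) (sg : {perm scolor n})
    (st : state n L) : Prop :=
  [/\ forall i : 'I_n, hedge st (delta_row i) ord_max = None,
      forall i : 'I_n, hedge st (gamma_row i) ord_max = Some (sg (inl i)),
      forall c : 'I_L, vedge st ord_max c = evec None
    & forall c : 'I_L, vedge st ord0 c = top_vec mu c.+1].

Definition state_weight (F : fieldType) (q qh s nu t : F) n L
    (x : 'I_n -> F) (st : state n L) : F :=
  \prod_(i < n)
    (Cweight qh nu t (x i)
       (hedge st (gamma_row i) ord0) (hedge st (delta_row i) ord0) *
     \prod_(c < L)
       (Lweight q s (x i)
          (bedge st (gamma_row i) c) (ledge st (gamma_row i) c)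
          (tedge st (gamma_row i) c) (redge st (gamma_row i) c) *
        Mweight q s (x i)
          (bedge st (delta_row i) c) (redge st (delta_row i) c)
          (tedge st (delta_row i) c) (ledge st (delta_row i) c))).

(* [\sum_(_ \in _)] is the finitely supported sum (0 on infinite support);
   see [finite_states] below. *)
Definition partition_function (F : fieldType) (q qh s nu t : F) n L
    (mu : 'I_n -> int) (sg : {perm scolor n}) (x : 'I_n -> F) : F :=
  \sum_(st \in [set st : state n L | admissible mu sg st]%classic)
    state_weight q qh s nu t x st.

Lemma state_weight_conserved (F : fieldType) (q qh s nu t : F) n L
    (x : 'I_n -> F) (st : state n L) (r : 'I_n.*2) (c : 'I_L) :
  state_weight q qh s nu t x st != 0 ->
  if odd r then conserved (bedge st r c) (ledge st r c)
                          (tedge st r c) (redge st r c)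
  else conserved (bedge st r c) (redge st r c)
                 (tedge st r c) (ledge st r c).
Proof.
have ltr : (r./2 < n)%N by rewrite ltn_half_double.
pose i := Ordinal ltr.
rewrite /state_weight => /prodf_neq0/(_ i isT).
rewrite mulf_eq0 negb_or => /andP[_ /prodf_neq0/(_ c isT)].
rewrite mulf_eq0 negb_or => /andP[hG hD].
case: ifP => odr.
  have -> : r = gamma_row i.
    by apply/val_inj; rewrite /= -[LHS]odd_double_half odr.
  by move: hG; rewrite /Lweight; case: ifPn => [|/negPn//]; rewrite eqxx.
have -> : r = delta_row i.
  by apply/val_inj; rewrite /= -[LHS]odd_double_half odr.
by move: hD; rewrite /Mweight; case: ifPn => [|/negPn//]; rewrite eqxx.
Qed.

Lemma finite_states (F : fieldType) (q qh s nu t : F) n L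
    (mu : 'I_n -> int) (sg : {perm scolor n}) (x : 'I_n -> F) :
  finite_set [set st : state n L |
    admissible mu sg st /\ state_weight q qh s nu t x st != 0]%classic.
Proof.
set A := (X in finite_set X).
suff injA : {in A &, injective (fun st : state n L => st.1)}.
  by rewrite -(eq_finite_set (inj_card_eq injA)); exact: finite_finset.
move=> st st' /set_mem[[_ _ b0 _] w0] /set_mem[[_ _ b0' _] w0'] eqh.
suff eqv (m : nat) (r : 'I_n.*2.+1) (c : 'I_L) :
    (n.*2 - r)%N = m -> vedge st r c = vedge st' r c.
  rewrite [st]surjective_pairing [st']surjective_pairing eqh; congr pair.
  by apply/ffunP => -[r c]; exact: (eqv _ r c erefl).
elim: m r => [|m IH] r hr.
  have -> : r = ord_max.
    by apply/val_inj/eqP; rewrite /= eqn_leq -ltnS ltn_ord -subn_eq0 hr.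
  by rewrite b0 b0'.
have ltr : (r < n.*2)%N by rewrite -subn_gt0 hr.
have -> : r = widen_ord (leqnSn n.*2) (Ordinal ltr) by exact/val_inj.
have eqb : bedge st (Ordinal ltr) c = bedge st' (Ordinal ltr) c.
  by apply: IH; rewrite /= /bump leq0n add1n subnS hr.
have := state_weight_conserved (Ordinal ltr) c w0'.
have := state_weight_conserved (Ordinal ltr) c w0.
rewrite eqb /ledge /redge /hedge eqh.
rewrite -![vedge _ (widen_ord _ (Ordinal ltr)) c]/(tedge _ (Ordinal ltr) c).
by case: ifP => _ /forallP e /forallP e'; apply/ffunP => k;
  move: (e' k); rewrite (eqP (e k)) => /eqP/addIn.
Qed.

(* Main.v *)
Require Import Defs.
From HB Require Import structures.
From mathcomp Require Import all_boot all_order all_fingroup all_algebra.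
From mathcomp Require Import all_classical all_reals.
From mathcomp Require Import complex.
From mathcomp Require Import zify ring.

Set Implicit Arguments.
Unset Strict Implicit.
Unset Printing Implicit Defensive.

Import Order.TTheory GRing.Theory Num.Theory.
Local Open Scope ring_scope.

(** With [Q_k = q ^ I_k] for a color [k] and [Q_0 = s^-2 q^-|I|] for the color 0
    (so that all the [Q_k] multiply to [s^-2]), every Gamma weight with incoming
    label [a] and outgoing label [c] is [s / (1 - s x)] times [prod_(k > c) Q_k]
    times [s Q_c - x], [- x (1 - Q_c)] or [- s (1 - Q_c)], according to whether
    [a = c], [a < c] or [a > c].  The Delta weights are the same weights for the
    reversed order of the labels.  Consequently two rows of the same kind satisfy
    a Yang-Baxter equation, a Gamma row and a Delta row satisfy a mixed one, in
    which the sums over all labels telescope, and the caps satisfy a reflection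
    equation.

    Let [P_x(a)] be the operator of a capped pair of rows with parameter [x] and
    left label [a].  The crossing of a Gamma row with a Delta row is forced at the
    left boundary, so up to the factor [1 - q x y] the product [P_y(b) P_x(a)] can
    be rewritten with both Gamma rows below both Delta rows.  Crossing the two
    Gamma rows produces the three terms of the theorem; by the reflection equation
    that crossing becomes a crossing of the two Delta rows, which is a scalar since
    both of their left labels are 0.  This settles the case [1 - q x y <> 0]; as
    both sides are rational in [x] without pole at the given point, it extends. *)

(** * Weights on a ranked set of labels *)

Section RankedWeights.
Variables (F : fieldType) (T : finType) (q s : F).
Implicit Types (rk : T -> nat) (Q : T -> F).

Definition upper rk Q (c : T) : F := \prod_(k | (rk c < rk k)%N) Q k.

Definition base_weight rk (x : F) Q (a c : T) : F :=
  upper rk Q c * (if (rk a < rk c)%N then - x * (1 - Q c)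
                  else if (rk c < rk a)%N then - s * (1 - Q c)
                  else s * Q c - x).

(** The change of the [Q_k] at a vertex where [a] enters from the side and [c] leaves. It is also
    right for the color 0: if 0 enters and a color leaves, [|I|] drops by one and [s^-2 q^-|I|]
    gains a factor [q]. *)
Definition shift Q (a c k : T) : F := Q k * q ^+ (k == a) / q ^+ (k == c).

(* A crossing with incoming labels [u], [v] and outgoing labels [u'], [v'], the
   unprimed and primed letters being on the same line: [dl], [dg] are the weights
   for keeping and [ol], [og] those for exchanging the labels, when the rank of
   [u] is less, resp. greater, than that of [v]. *)
Definition rmat rk (e dl ol dg og : F) (u v u' v' : T) : F :=
  if (rk u < rk v)%N then
    dl *+ ((u' == u) && (v' == v)) + ol *+ ((u' == v) && (v' == u))
  else if (rk v < rk u)%N then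
    dg *+ ((u' == u) && (v' == v)) + og *+ ((u' == v) && (v' == u))
  else e *+ ((u' == u) && (v' == v)).

(** The crossings of two rows of the same kind and, below, of a Gamma row with a Delta row. Both are
    stochastic up to a scalar: for given [u], [v] the weights add up to [x - q * y], resp.
    [q * (1 - z)]. *)
Definition rsame rk (x y : F) :=
  rmat rk (x - q * y) (q * (x - y)) ((1 - q) * x) (x - y) ((1 - q) * y).

Definition rmix rk (z : F) :=
  rmat rk (q * (1 - z)) (q * (1 - q * z)) (q * (q - 1) * z) (1 - q * z) (q - 1).

Section Ranked.
Variable rk : T -> nat.
Hypothesis rkI : injective rk.

Lemma rk_eq (a b : T) : (a == b) = (rk a == rk b).
Proof. by rewrite (inj_eq rkI). Qed.

Lemma sum_pair_delta (f : T -> T -> F) (u v : T) (w : F) :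
  \sum_u' \sum_v' (w *+ ((u' == u) && (v' == v))) * f u' v' = w * f u v.
Proof.
rewrite (bigD1 u) //= (bigD1 v) //= !eqxx mulr1n [X in _ + X + _]big1; last first.
  by move=> i /negPf->; rewrite mulr0n mul0r.
rewrite addr0 big1 ?addr0 // => i /negPf->.
by rewrite big1 // => j _; rewrite mulr0n mul0r.
Qed.

Lemma sum_rmat e dl ol dg og (u v : T) (f : T -> T -> F) :
  \sum_u' \sum_v' rmat rk e dl ol dg og u v u' v' * f u' v' =
  if (rk u < rk v)%N then dl * f u v + ol * f v u
  else if (rk v < rk u)%N then dg * f u v + og * f v u else e * f u v.
Proof.
rewrite -!sum_pair_delta /rmat; case: ifP => _; [|case: ifP => _ //].
  rewrite -big_split; apply: eq_bigr => u' _; rewrite -big_split.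
  by apply: eq_bigr => v' _; rewrite mulrDl.
rewrite -big_split; apply: eq_bigr => u' _; rewrite -big_split.
by apply: eq_bigr => v' _; rewrite mulrDl.
Qed.

Lemma rmatC e dl ol dg og (u v u' v' : T) :
  rmat rk e dl ol dg og u v u' v' = rmat rk e dl og dg ol u' v' u v.
Proof.
rewrite /rmat !rk_eq.
case: (ltngtP (rk u) (rk v)) => h1; case: (ltngtP (rk u') (rk v')) => h2;
  do ?[case: eqP => ?]; rewrite /= ?mulr1n ?mulr0n ?addr0 ?add0r //; lia.
Qed.

Lemma sum_rmat_tr e dl ol dg og (u v : T) (f : T -> T -> F) :
  \sum_u' \sum_v' f u' v' * rmat rk e dl ol dg og u' v' u v =
  if (rk u < rk v)%N then dl * f u v + og * f v u
  else if (rk v < rk u)%N then dg * f u v + ol * f v u else e * f u v.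
Proof.
rewrite -sum_rmat; apply: eq_bigr => u' _; apply: eq_bigr => v' _.
by rewrite rmatC mulrC.
Qed.

Lemma prod_q_if (P : pred T) (a : T) :
  \prod_(k | P k) q ^+ (k == a) = q ^+ (P a).
Proof.
case Pa: (P a).
  rewrite (bigD1 a) //= eqxx big1 ?mulr1 // => k /andP[_ /negPf->].
  by rewrite expr0.
by rewrite big1 // => k Pk; case: eqP => // e; rewrite e Pa in Pk.
Qed.

Lemma prod_shift (P : pred T) Q (a c : T) :
  \prod_(k | P k) shift Q a c k =
  \prod_(k | P k) Q k * q ^+ (P a) / q ^+ (P c).
Proof. by rewrite /shift !big_split /= prodfV !prod_q_if. Qed.

Lemma upper_shift Q (a c d : T) :
  upper rk (shift Q a c) d =
  upper rk Q d * q ^+ (rk d < rk a)%N / q ^+ (rk d < rk c)%N.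
Proof. by rewrite /upper prod_shift. Qed.

Hypothesis q0 : q != 0.

(** The crossing only keeps or exchanges two labels, so each side has at most two terms, and their
    form depends only on the relative order of the labels; each order gives a field identity. *)
Lemma base_weight_ybe (x y : F) Q (a b c d : T) :
  \sum_a' \sum_b' rsame rk x y a b a' b' *
    (base_weight rk x Q a' c * base_weight rk y (shift Q a' c) b' d) =
  \sum_c' \sum_d' (base_weight rk y Q b d' * base_weight rk x (shift Q b d') a c') *
    rsame rk x y c' d' c d.
Proof.
rewrite sum_rmat sum_rmat_tr /base_weight !upper_shift /shift !rk_eq.
set Sc := upper rk Q c; set Sd := upper rk Q d.
(* Before the values at [c] and [d] are generalized, the relation between them is kept: they
   coincide when [c = d]. *)
have eqQ : rk c = rk d -> [/\ Q c = Q d & Sc = Sd] by rewrite /Sc => /rkI->.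
move: eqQ; move: Sc Sd (Q c) (Q d) => Sc Sd Qc Qd.
case: (ltngtP (rk c) (rk d)) => hcd eqQ;
 [ | | case: eqQ => // -> ->];
case: (ltngtP (rk a) (rk b)) => hab;
case: (ltngtP (rk a) (rk c)) => hac; try lia;
case: (ltngtP (rk a) (rk d)) => had; try lia;
case: (ltngtP (rk b) (rk c)) => hbc; try lia;
case: (ltngtP (rk b) (rk d)) => hbd; try lia;
rewrite ?expr0 ?expr1 ?mulr1 ?divr1; clear -q0; by field.
Qed.
End Ranked.
End RankedWeights.

(* [(1 - Q m) * upper rk Q m] is a difference of two consecutive tail products,
   so the sum of a function that is a constant multiple of it between marked
   labels is explicit. *)
Section Telescope.
Variables (F : fieldType) (T : finType) (rk : T -> nat).
Hypothesis rkI : injective rk.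
Implicit Types (Q f : T -> F).

Lemma sum_rank_split f (P1 P2 P : pred T) (p : T) :
  (forall m, P m = [|| P1 m, P2 m | m == p]) ->
  (forall m, P1 m -> ~~ P2 m) -> ~~ P1 p -> ~~ P2 p ->
  \sum_(m | P m) f m = \sum_(m | P1 m) f m + f p + \sum_(m | P2 m) f m.
Proof.
move=> hP h12 h1 h2; rewrite (bigD1 p) /=; last by rewrite hP eqxx !orbT.
rewrite [_ + f p]addrC -addrA; congr (_ + _).
rewrite (bigID P1) /=; congr (_ + _); apply: eq_bigl => m; rewrite hP.
  case: (eqVneq m p) => [->|_]; first by rewrite (negPf h1) !andbF.
  by case: (P1 m); rewrite ?andbF //= !andbT.
case: (eqVneq m p) => [->|_]; first by rewrite (negPf h2) !andbF.
by case h: (P1 m); rewrite /= ?andbF ?andbT ?orbF // (negPf (h12 _ h)).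
Qed.

Let tail Q (k : nat) : F := \prod_(m | (k <= rk m)%N) Q m.

Lemma sum_tail Q (u v : nat) : (u <= v)%N ->
  \sum_(m | (u <= rk m < v)%N) (1 - Q m) * upper rk Q m = tail Q v - tail Q u.
Proof.
move=> /subnKC <-; elim: (v - u)%N => [|d IH].
  by rewrite addn0 subrr big1 // => m; lia.
(* By injectivity at most one label has rank [u + d]; if there is none, neither side changes. *)
rewrite addnS; case: (pickP (fun m => rk m == u + d)%N) => [p /eqP hp|none].
  rewrite (@sum_rank_split _ (fun m => u <= rk m < u + d)%N pred0 _ p); first last.
  - by [].
  - lia.
  - by [].
  - by move=> m; rewrite (rk_eq rkI) /=; lia.
  rewrite IH big_pred0 // addr0.
  have -> : tail Q (u + d) = Q p * upper rk Q p.
    rewrite /tail (bigD1 p) /=; last by lia.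
    by congr (_ * _); apply: eq_bigl => m; rewrite (rk_eq rkI); lia.
  have -> : tail Q (u + d).+1 = upper rk Q p.
    by apply: eq_bigl => m; lia.
  by ring.
have -> : tail Q (u + d).+1 = tail Q (u + d).
  by apply: eq_bigl => m; have := none m; lia.
by rewrite -IH; apply: eq_bigl => m; have := none m; lia.
Qed.

Let bound := (\max_m rk m).+1.

Lemma rk_bound m : (rk m < bound)%N.
Proof. by rewrite ltnS (bigmaxD1 m) // leq_maxl. Qed.

Lemma tail0 Q : tail Q 0 = \prod_m Q m.
Proof. by []. Qed.

Lemma tail_bound Q : tail Q bound = 1.
Proof. by rewrite /tail big1 // => m; have := rk_bound m; lia. Qed.

Lemma tail_rk Q m : tail Q (rk m) = Q m * upper rk Q m.
Proof.
rewrite /tail (bigD1 m) //=.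
by congr (_ * _); apply: eq_bigl => k; rewrite (rk_eq rkI); lia.
Qed.

Lemma tail_rkS Q m : tail Q (rk m).+1 = upper rk Q m.
Proof. by []. Qed.

Lemma sum_region f Q (u v : nat) (k : F) : (u <= v)%N ->
  (forall m, (u <= rk m)%N -> (rk m < v)%N -> f m = k * ((1 - Q m) * upper rk Q m)) ->
  \sum_(m | (u <= rk m < v)%N) f m = k * (tail Q v - tail Q u).
Proof.
move=> uv h; rewrite -sum_tail // mulr_sumr; apply: eq_bigr => m /andP[? ?].
exact: h.
Qed.

Lemma split_at f (u v : nat) p : (u <= rk p < v)%N ->
  \sum_(m | (u <= rk m < v)%N) f m =
  \sum_(m | (u <= rk m < rk p)%N) f m + f p +
  \sum_(m | ((rk p).+1 <= rk m < v)%N) f m.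
Proof.
move=> h; apply: sum_rank_split => [m|m||]; rewrite ?(rk_eq rkI); lia.
Qed.

Lemma sum_all f : \sum_m f m = \sum_(m | (0 <= rk m < bound)%N) f m.
Proof. by apply: eq_bigl => m; rewrite rk_bound. Qed.

(** The summand is arbitrary at a marked label. The two ends come from the tail at rank 0, which is
    the full product, and from the empty tail above all ranks, which is 1. Two and three marks are
    treated in the same way. *)
Lemma sum_mark1 f Q p k0 k1 :
  (forall m, (rk m < rk p)%N -> f m = k0 * ((1 - Q m) * upper rk Q m)) ->
  (forall m, (rk p < rk m)%N -> f m = k1 * ((1 - Q m) * upper rk Q m)) ->
  \sum_m f m = k0 * (Q p * upper rk Q p - \prod_m Q m) + f p + k1 * (1 - upper rk Q
    p).
Proof.
move=> h0 h1; have hp := rk_bound p.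
rewrite sum_all (@split_at _ _ _ p) // (@sum_region _ Q _ _ k0) //; last by move=> m
  *; apply: h0.
rewrite (@sum_region _ Q _ _ k1) //; last by move=> m *; apply: h1.
by rewrite tail_bound tail_rk tail_rkS tail0.
Qed.

Lemma sum_mark2 f Q p p' k0 k1 k2 : (rk p < rk p')%N ->
  (forall m, (rk m < rk p)%N -> f m = k0 * ((1 - Q m) * upper rk Q m)) ->
  (forall m, (rk p < rk m)%N -> (rk m < rk p')%N ->
     f m = k1 * ((1 - Q m) * upper rk Q m)) ->
  (forall m, (rk p' < rk m)%N -> f m = k2 * ((1 - Q m) * upper rk Q m)) ->
  \sum_m f m = k0 * (Q p * upper rk Q p - \prod_m Q m) + f p +
    (k1 * (Q p' * upper rk Q p' - upper rk Q p) + f p' + k2 * (1 - upper rk Q p')).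
Proof.
move=> pp' h0 h1 h2; have hp := rk_bound p; have hp' := rk_bound p'.
rewrite sum_all (@split_at _ _ _ p) // (@sum_region _ Q _ _ k0) //; last by move=> m
  *; apply: h0.
rewrite (@split_at _ _ _ p'); last by rewrite pp'.
rewrite (@sum_region _ Q _ _ k1) //.
rewrite (@sum_region _ Q _ _ k2) //; last by move=> m *; apply: h2.
by rewrite tail_bound !tail_rk !tail_rkS tail0.
Qed.

Lemma sum_mark3 f Q p p' p'' k0 k1 k2 k3 :
  (rk p < rk p')%N -> (rk p' < rk p'')%N ->
  (forall m, (rk m < rk p)%N -> f m = k0 * ((1 - Q m) * upper rk Q m)) ->
  (forall m, (rk p < rk m)%N -> (rk m < rk p')%N ->
     f m = k1 * ((1 - Q m) * upper rk Q m)) ->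
  (forall m, (rk p' < rk m)%N -> (rk m < rk p'')%N ->
     f m = k2 * ((1 - Q m) * upper rk Q m)) ->
  (forall m, (rk p'' < rk m)%N -> f m = k3 * ((1 - Q m) * upper rk Q m)) ->
  \sum_m f m = k0 * (Q p * upper rk Q p - \prod_m Q m) + f p +
    (k1 * (Q p' * upper rk Q p' - upper rk Q p) + f p' +
     (k2 * (Q p'' * upper rk Q p'' - upper rk Q p') + f p'' + k3 * (1 - upper rk Q
       p''))).
Proof.
move=> pp' pp'' h0 h1 h2 h3.
have hp := rk_bound p; have hp' := rk_bound p'; have hp'' := rk_bound p''.
rewrite sum_all (@split_at _ _ _ p) // (@sum_region _ Q _ _ k0) //; last by move=> m
  *; apply: h0.
rewrite (@split_at _ _ _ p'); last by rewrite pp'.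
rewrite (@sum_region _ Q _ _ k1) //.
rewrite (@split_at _ _ _ p''); last by rewrite pp''.
rewrite (@sum_region _ Q _ _ k2) //.
rewrite (@sum_region _ Q _ _ k3) //; last by move=> m *; apply: h3.
by rewrite tail_bound !tail_rk !tail_rkS tail0.
Qed.

End Telescope.

(** * Crossings read sideways *)

Section CrossSum.
Variables (F : fieldType) (T : finType) (rk : T -> nat).
Hypothesis rkI : injective rk.

(** One label is fixed on each side of the crossing. If the fixed labels [a] and [l] differ, nothing
    can be exchanged and the other two are forced; if they agree, the other two are an arbitrary
    equal pair. This free pair is the source of the sums over all labels in the mixed equation. *)
Lemma rmat_transposed e dl ol dg og (a l a' l' : T) :
  rmat rk e dl ol dg og a l' a' l =
  if (rk a < rk l)%N then dl *+ ((l' == l) && (a' == a))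
  else if (rk l < rk a)%N then dg *+ ((l' == l) && (a' == a))
  else (if (rk a < rk l')%N then ol
        else if (rk l' < rk a)%N then og else e) *+ (a' == l') :> F.
Proof.
rewrite /rmat !(rk_eq rkI).
case: (ltngtP (rk a) (rk l)) => h1; case: (ltngtP (rk a) (rk l')) => h2;
  do ?[case: eqP => ?]; rewrite /= ?mulr1n ?mulr0n ?addr0 ?add0r //; lia.
Qed.

Lemma sum_diag (w f : T -> T -> F) :
  \sum_u \sum_v (w u v *+ (v == u)) * f u v = \sum_u w u u * f u u.
Proof.
apply: eq_bigr => u _; rewrite (bigD1 u) //= eqxx big1 ?addr0 // => v /negPf->.
by rewrite mulr0n mul0r.
Qed.

Lemma sum_rmat_out e dl ol dg og (a l : T) (f : T -> T -> F) :
  \sum_l' \sum_a' rmat rk e dl ol dg og a l' a' l * f l' a' =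
  if (rk a < rk l)%N then dl * f l a
  else if (rk l < rk a)%N then dg * f l a
  else \sum_m (if (rk a < rk m)%N then ol
               else if (rk m < rk a)%N then og else e) * f m m.
Proof.
under eq_bigr => l' _ do under eq_bigr => a' _ do rewrite rmat_transposed.
case: ltngtP => _; [exact: sum_pair_delta | exact: sum_pair_delta |].
exact: (sum_diag (fun u _ => if (rk a < rk u)%N then ol
                             else if (rk u < rk a)%N then og else e)).
Qed.

Lemma sum_rmat_in e dl ol dg og (c j : T) (f : T -> T -> F) :
  \sum_c' \sum_j' f c' j' * rmat rk e dl ol dg og c' j c j' =
  if (rk c < rk j)%N then dl * f c j
  else if (rk j < rk c)%N then dg * f c j
  else \sum_m (if (rk m < rk c)%N then ol
               else if (rk c < rk m)%N then og else e) * f m m.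
Proof.
rewrite exchange_big /=.
under eq_bigr => j' _ do under eq_bigr => c' _ do rewrite (rmatC rkI) mulrC.
rewrite (sum_rmat_out _ _ _ _ _ _ _ (fun u v => f v u)).
case: ltngtP => // _; apply: eq_bigr => m _; congr (_ * _).
by case: ltngtP.
Qed.

End CrossSum.

(** * The mixed Yang-Baxter equation *)

Section MixedYBE.
Variables (F : fieldType) (T : finType) (q s : F).
Hypotheses (q0 : q != 0) (s0 : s != 0).
Section Ranked.
Variables (rk rk' : T -> nat).
Hypotheses (rkI : injective rk) (rkI' : injective rk').
Hypothesis rev : forall a b, (rk' a < rk' b)%N = (rk b < rk a)%N.

Ltac cmp m a := case: (ltngtP (rk m) (rk a)) => ?; try lia.
Ltac resolve :=
  rewrite /base_weight ?upper_shift /shift ?(rk_eq rkI) ?rev.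
Ltac unlet := repeat match goal with h := _ |- _ => subst h end.
Ltac clean := rewrite ?expr0 ?expr1 ?mulr1 ?divr1.
Ltac region a c j := let m := fresh "m" in move=> m; rewrite ?rev => *;
  resolve; cmp a m; cmp m c; cmp j m; cmp j c; rewrite ?ltnn ?eqxx; clean; unlet;
    clean; clear -q0 s0; field; by rewrite ?q0 ?s0.

Ltac finish a c j := resolve;
  cmp a c; cmp c j; cmp a j; rewrite ?ltnn ?eqxx; unlet; clean; clear -q0 s0; field;
    by rewrite ?q0 ?s0.

(** The case [a = l] of the mixed equation. Conservation leaves the label [m] free, and the sum over
    [m] telescopes between the marks [a], [c], [j]; its end at rank 0 is the full product, where
    [s ^- 2] enters. *)
Lemma mixed_ybe_out (x y : F) Q (a c j : T) :
  \prod_m Q m = s ^- 2 -> rk c != rk j ->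
  \sum_m (if (rk a < rk m)%N then q * (q - 1) * (x * y)
          else if (rk m < rk a)%N then q - 1 else q * (1 - x * y)) *
     (base_weight s rk' y Q j m * base_weight s rk x (shift q Q j m) m c) =
  (if (rk c < rk j)%N then q * (1 - q * (x * y)) else 1 - q * (x * y)) *
  (base_weight s rk x Q a c * base_weight s rk' y (shift q Q a c) j a).
Proof.
move=> htot hcj.
set oL := q * (q - 1) * (x * y); set oG := q - 1.
(* [wL] and [wG] are the values of the second weight for [m] below and above [c]. *)
pose Uc := upper rk Q c.
pose dc := q ^+ (rk c < rk j)%N.
pose wL := Uc * (- x) * (1 - Q c) * dc.
pose wG := Uc * (- s) * (1 - Q c) * dc / q.
case: (ltngtP (rk c) (rk j)) @dc @wL @wG hcj => // hcj dc wL wG _; cmp a c; cmp a j;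
  try (match goal with h : rk a = rk j |- _ => move/rkI: h => h; subst j end);
  try (match goal with h : rk a = rk c |- _ => move/rkI: h => h; subst c end).
(* The marks increase for [rk'], so [m] descends for [rk]. Each constant is a product of [oL] or
   [oG] ([m] above or below [a]), [-s] or [-y] (above or below [j]) and [wG] or [wL] (above or below
   [c]). *)
- rewrite (@sum_mark3 _ _ rk' rkI' _ Q j c a
    (oL * (-s) * wG) (oL * (-y) * wG) (oL * (-y) * wL) (oG * (-y) * wL));
  try (by rewrite rev); try (by region a c j).
  rewrite htot; finish a c j.
- rewrite (@sum_mark3 _ _ rk' rkI' _ Q j a c
    (oL * (-s) * wG) (oL * (-y) * wG) (oG * (-y) * wG) (oG * (-y) * wL));
  try (by rewrite rev); try (by region a c j).
  rewrite htot; finish a c j.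
- rewrite (@sum_mark3 _ _ rk' rkI' _ Q a j c
    (oL * (-s) * wG) (oG * (-s) * wG) (oG * (-y) * wG) (oG * (-y) * wL));
  try (by rewrite rev); try (by region a c j).
  rewrite htot; finish a c j.
- rewrite (@sum_mark2 _ _ rk' rkI' _ Q a c
    (oL * (-s) * wG) (oG * (-y) * wG) (oG * (-y) * wL));
  try (by rewrite rev); try (by region a c a).
  rewrite htot; finish a c a.
- rewrite (@sum_mark2 _ _ rk' rkI' _ Q j a
    (oL * (-s) * wG) (oL * (-y) * wG) (oG * (-y) * wL));
  try (by rewrite rev); try (by region a a j).
  rewrite htot; finish a a j.
- rewrite (@sum_mark3 _ _ rk' rkI' _ Q c j a
    (oL * (-s) * wG) (oL * (-s) * wL) (oL * (-y) * wL) (oG * (-y) * wL));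
  try (by rewrite rev); try (by region a c j).
  rewrite htot; finish a c j.
- rewrite (@sum_mark3 _ _ rk' rkI' _ Q c a j
    (oL * (-s) * wG) (oL * (-s) * wL) (oG * (-s) * wL) (oG * (-y) * wL));
  try (by rewrite rev); try (by region a c j).
  rewrite htot; finish a c j.
- rewrite (@sum_mark2 _ _ rk' rkI' _ Q c a
    (oL * (-s) * wG) (oL * (-s) * wL) (oG * (-y) * wL));
  try (by rewrite rev); try (by region a c a).
  rewrite htot; finish a c a.
- rewrite (@sum_mark3 _ _ rk' rkI' _ Q a c j
    (oL * (-s) * wG) (oG * (-s) * wG) (oG * (-s) * wL) (oG * (-y) * wL));
  try (by rewrite rev); try (by region a c j).
  rewrite htot; finish a c j.
- rewrite (@sum_mark2 _ _ rk' rkI' _ Q a j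
    (oL * (-s) * wG) (oG * (-s) * wL) (oG * (-y) * wL));
  try (by rewrite rev); try (by region a a j).
  rewrite htot; finish a a j.
Qed.

Ltac final a c SE u0 Q0 := resolve;
  cmp a c; rewrite ?ltnn ?eqxx; unlet; clean; rewrite !SE;
  move: (u0 a) (u0 c) (Q0 a) (Q0 c) => *; field;
  rewrite ?q0 ?s0 ?u0 ?Q0 //.

Lemma upper_total (Q : T -> F) (c : T) : upper rk Q c * Q c * upper rk' Q c = \prod_m
  Q m.
Proof.
rewrite [RHS](bigD1 c) //= (bigID (fun m => rk c < rk m)%N) /= mulrCA mulrA.
congr (_ * _ * _); apply: eq_bigl => m; rewrite (rk_eq rkI) ?rev; lia.
Qed.

Lemma mixed_ybe_diag (x y : F) Q (a c : T) :
  \prod_m Q m = s ^- 2 -> (forall m, Q m != 0) ->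
  \sum_m (if (rk a < rk m)%N then q * (q - 1) * (x * y)
          else if (rk m < rk a)%N then q - 1 else q * (1 - x * y)) *
     (base_weight s rk' y Q c m * base_weight s rk x (shift q Q c m) m c) =
  \sum_m (if (rk m < rk c)%N then q * (q - 1) * (x * y)
          else if (rk c < rk m)%N then q - 1 else q * (1 - x * y)) *
     (base_weight s rk x Q a m * base_weight s rk' y (shift q Q a m) m a).
Proof.
move=> htot Q0.
set oL := q * (q - 1) * (x * y); set oG := q - 1.
have u0 m : upper rk' Q m != 0 by apply/prodf_neq0 => ? _; exact: Q0.
(* Both sides are compared in terms of [Q] and [upper rk']; the total product eliminates
   [upper rk]. *)
have SE m : upper rk Q m = s ^- 2 / (Q m * upper rk' Q m).
  by rewrite -htot -(upper_total Q m) -mulrA mulfK ?mulf_neq0.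
(* The second factors of the two sides, for [m] below or above the mark [c] ([wL], [wG]), resp. [a]
   ([vL], [vG]). The label leaving at the second vertex has just entered at the first one, hence
   [Q c * q] and [Q a * q]. *)
pose wL := upper rk Q c * (- x) * (1 - Q c * q).
pose wG := upper rk Q c * (- s) * (1 - Q c * q) / q.
pose vG := upper rk' Q a * (- y) * (1 - Q a * q).
pose vL := upper rk' Q a * (- s) * (1 - Q a * q) / q.
case: (ltngtP (rk a) (rk c)) => h.
- rewrite (@sum_mark2 _ _ rk' rkI' _ Q c a
    (oL * (-s) * wG) (oL * (-y) * wL) (oG * (-y) * wL));
  try (by rewrite rev); try (by region a c c).
  rewrite (@sum_mark2 _ _ rk rkI _ Q a c
    (oL * (-s) * vL) (oL * (-x) * vG) (oG * (-x) * vG)) //;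
  try (by region a c c).
  rewrite !htot; final a c SE u0 Q0.
- rewrite (@sum_mark2 _ _ rk' rkI' _ Q a c
    (oL * (-s) * wG) (oG * (-s) * wG) (oG * (-y) * wL));
  try (by rewrite rev); try (by region a c c).
  rewrite (@sum_mark2 _ _ rk rkI _ Q c a
    (oL * (-s) * vL) (oG * (-s) * vL) (oG * (-x) * vG)) //;
  try (by region a c c).
  rewrite !htot; final a c SE u0 Q0.
have {}h : a = c by exact: rkI.
subst c.
rewrite (@sum_mark1 _ _ rk' rkI' _ Q a (oL * (-s) * wG) (oG * (-y) * wL));
  try (by region a a a).
rewrite (@sum_mark1 _ _ rk rkI _ Q a (oL * (-s) * vL) (oG * (-x) * vG)) //;
  try (by region a a a).
rewrite !htot; final a a SE u0 Q0.
Qed.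

Lemma mixed_ybe_off (x y : F) Q (a l c j : T) : rk a != rk l -> rk c != rk j ->
  (if (rk a < rk l)%N then q * (1 - q * (x * y)) else 1 - q * (x * y)) *
    (base_weight s rk' y Q j l * base_weight s rk x (shift q Q j l) a c) =
  (if (rk c < rk j)%N then q * (1 - q * (x * y)) else 1 - q * (x * y)) *
    (base_weight s rk x Q a c * base_weight s rk' y (shift q Q a c) j l).
Proof.
resolve; case: (ltngtP (rk c) (rk l)) => hcl; last move/rkI: hcl => ?; try subst l;
cmp a c; cmp j c; try (cmp a l); try (cmp j l); rewrite ?ltnn ?eqxx // => _ _;
clean; clear -q0 s0; field; rewrite ?q0 ?s0 //.
Qed.

End Ranked.

(** On each side a free pair is summed over exactly when the two fixed labels of the crossing agree:
    [a = l] on the left, [c = j] on the right. This gives four cases. *)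
Lemma mixed_ybe (rk rk' : T -> nat) (rkI : injective rk) (rkI' : injective rk')
    (rev : forall u v, (rk' u < rk' v)%N = (rk v < rk u)%N)
    (x y : F) (Q : T -> F) (a l c j : T) :
  \prod_m Q m = s ^- 2 -> (forall m, Q m != 0) ->
  \sum_l' \sum_a' rmix q rk (x * y) a l' a' l *
     (base_weight s rk' y Q j l' * base_weight s rk x (shift q Q j l') a' c) =
  \sum_c' \sum_j' (base_weight s rk x Q a c' * base_weight s rk' y (shift q Q a c')
    j' l) *
     rmix q rk (x * y) c' j c j'.
Proof.
move=> htot Q0; rewrite (sum_rmat_out rkI) (sum_rmat_in rkI).
have tri (m n : nat) (u v w : F) :
  (if m < n then u else if n < m then v else w)%N =
  if m == n then w else if (m < n)%N then u else v by case: ltngtP.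
rewrite !tri -!(rk_eq rkI).
case: (eqVneq a l) => [<-|]; case: (eqVneq c j) => [<-|].
- by move=> *; apply: mixed_ybe_diag.
- by rewrite (rk_eq rkI) => hcj; rewrite (mixed_ybe_out rkI rkI' rev) //; case: ifP;
  rewrite ?mulrA.
(* The mirror image of [mixed_ybe_out]: the two orders and the two parameters are exchanged, and the
   equation is read from right to left. *)
- rewrite (rk_eq rkI) => hal.
  have hal' : rk' l != rk' a by rewrite (inj_eq rkI') eq_sym (rk_eq rkI).
  have rev' u v : (rk u < rk v)%N = (rk' v < rk' u)%N by rewrite rev.
  have := mixed_ybe_out rkI' rkI rev' y x c htot hal'.
  rewrite rev (mulrC x y) => E.
  transitivity ((if (rk a < rk l)%N then q * (1 - q * (y * x)) else 1 - q * (y * x)) *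
    (base_weight s rk' y Q c l * base_weight s rk x (shift q Q c l) a c)); first by
      case: ifP.
  rewrite -E.
  by apply: eq_bigr => m _; rewrite !rev.
- rewrite !(rk_eq rkI) => hcj hal; have := mixed_ybe_off rkI rev x y Q hal hcj.
  by case: ifP; case: ifP.
Qed.
End MixedYBE.

(** * Gamma and Delta weights *)

Section Labels.
Variable n : nat.
Implicit Types (a b c : label n) (I : cvec n).

Lemma rank_le a : (rank a <= n.*2)%N.
Proof. by case: a => [[]i|] /=; try (have := ltn_ord i); lia. Qed.

Lemma rank_inj : injective (@rank n).
Proof.
by case=> [[]i|] [[]j|] //= h;
  try (have ? := ltn_ord i); try (have ? := ltn_ord j);
  try lia; congr (Some (_ _)); apply/val_inj => /=; lia.
Qed.

Definition rev_rank a := (n.*2 - rank a)%N.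

Lemma rev_rank_lt a b : (rev_rank a < rev_rank b)%N = (rank b < rank a)%N.
Proof. by rewrite /rev_rank; have := rank_le a; have := rank_le b; lia. Qed.

Lemma rev_rank_inj : injective rev_rank.
Proof.
by move=> a b; rewrite /rev_rank; have := rank_le a; have := rank_le b => ? ? ?;
  apply: rank_inj; lia.
Qed.

(* Truncated subtraction: the value is junk when [c] is absent from [I + e_a], but
   then the weight vanishes by [base_weight_not_conserved]. *)
Definition transfer I a c : cvec n := [ffun k => (I k + evec a k - evec c k)%N].

Lemma evecE a k : evec a k = (a == Some k) :> nat.
Proof. by rewrite ffunE. Qed.

Lemma conserved_transfer I a K c : conserved I a K c -> K = transfer I a c.
Proof. by move=> /forallP h; apply/ffunP => k; rewrite ffunE (eqP (h k)) addnK. Qed.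

Lemma conserved_transferE I a c : conserved I a (transfer I a c) c =
  (if c is Some k then (a == c) || (0 < I k)%N else true).
Proof.
apply/forallP/idP => [h|h k].
  case: c h => // k /(_ k) /eqP; rewrite !ffunE eqxx.
  by case: (a == Some k) => //=; lia.
rewrite !ffunE; case: c h => [k'|] /=; last by rewrite addn0 subn0.
case: (eqVneq (Some k') (Some k)) => [[->]|_] /=; last by rewrite addn0 subn0.
by case: (a == _) => /=; lia.
Qed.
End Labels.

Section Weights.
Variables (F : fieldType) (q s : F) (n : nat).
Hypotheses (q0 : q != 0) (s0 : s != 0).
Implicit Types (a b c : label n) (I : cvec n) (x : F).

Definition color_pow I (a : label n) : F :=
  if a is Some k then q ^+ I k else s ^- 2 * q ^- sumv I predT.

Lemma color_pow_neq0 I a : color_pow I a != 0.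
Proof. by case: a => [k|] /=; rewrite ?mulf_neq0 ?invr_eq0 ?expf_neq0. Qed.

Lemma prod_label (f : label n -> F) (P : pred (label n)) :
  \prod_(m | P m) f m =
  (if P None then f None else 1) * \prod_(k | P (Some k)) f (Some k).
Proof.
rewrite big_mkcond (bigD1 None) //=; congr (_ * _).
rewrite (reindex_omap Some id) /=; last by case.
by rewrite [RHS]big_mkcond; apply: eq_bigl => k; rewrite eqxx.
Qed.

(** The color 0 lies above every positive color, so the product contains [s^-2 q^-|I|]; this cancels
    the colors above and leaves the negative power over the colors up to the given one. *)
Lemma upper_rank_pos I (i : 'I_n) :
  upper (@rank n) (color_pow I) (Some (inl i)) = s ^- 2 * q ^- sum_le I (inl i).
Proof.
rewrite /upper prod_label /= ltn_ord prodrXr -mulrA; congr (_ * _).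
have -> : sumv I predT = (sum_le I (inl i) + \sum_(k | (i < rank (Some k))%N) I k)%N.
  rewrite /sumv (bigID (fun k => lel (Some k) (Some (inl i)))) /=.
  by congr addn; apply: eq_bigl => k; rewrite -ltnNge.
by rewrite exprD invfM mulfVK ?expf_neq0.
Qed.

Lemma upper_rank_neg I (i : 'I_n) :
  upper (@rank n) (color_pow I) (Some (inr i)) = q ^+ sum_gt I (inr i).
Proof.
rewrite /upper prod_label /= prodrXr.
by rewrite ifF ?mul1r //; have := ltn_ord i; lia.
Qed.

Lemma upper_rank_zero I : upper (@rank n) (color_pow I) None = q ^+ sum_neg I.
Proof.
rewrite /upper prod_label /= prodrXr ltnn mul1r; congr (_ ^+ _).
by apply: eq_bigl => -[] i /=; have := ltn_ord i; lia.
Qed.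

Lemma upper_rev_rank_pos I (i : 'I_n) :
  upper (@rev_rank n) (color_pow I) (Some (inl i)) = q ^+ sum_lt I (inl i).
Proof.
rewrite /upper prod_label prodrXr.
rewrite rev_rank_lt /= ltnNge ltnW // mul1r; congr (_ ^+ _).
by apply: eq_bigl => k; rewrite rev_rank_lt.
Qed.

Lemma upper_rev_rank_neg I (i : 'I_n) :
  upper (@rev_rank n) (color_pow I) (Some (inr i)) = s ^- 2 * q ^- sum_ge I (inr i).
Proof.
rewrite /upper prod_label prodrXr rev_rank_lt.
rewrite ifT; last by rewrite /=; have := ltn_ord i; lia.
rewrite -mulrA; congr (_ * _).
have -> : sumv I predT = (sum_ge I (inr i) + \sum_(k | (rank (Some k) < rank (Some
  (inr i)))%N) I k)%N.
  rewrite /sumv (bigID (fun k => lel (Some (inr i)) (Some k))) /=.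
  by congr addn; apply: eq_bigl => k; rewrite -ltnNge.
rewrite [X in _ * q ^+ X](eq_bigl
  (fun k => (rank (Some k) < rank (Some (inr i)))%N)); last by move=> k; rewrite rev_rank_lt.
by rewrite exprD invfM mulfVK ?expf_neq0.
Qed.

Lemma upper_rev_rank_zero I : upper (@rev_rank n) (color_pow I) None = q ^+ sum_pos I.
Proof.
rewrite /upper prod_label prodrXr ltnn mul1r; congr (_ ^+ _).
by apply: eq_bigl => -[] i /=; rewrite rev_rank_lt /=; have := ltn_ord i; lia.
Qed.

Lemma color_pow_prod I : \prod_m color_pow I m = s ^- 2.
Proof.
by rewrite prod_label /= prodrXr mulfVK ?expf_neq0.
Qed.

Definition flow_weight (rk : label n -> nat) x I a c := s / (1 - s * x) * base_weight
  s rk x (color_pow I) a c.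

Lemma sumv_split I : sumv I predT = (sum_pos I + sum_neg I)%N.
Proof. by rewrite /sumv (bigID (@is_pos n)). Qed.

Lemma base_weight_not_conserved rk (rkI : injective rk) x I a c : ~~ conserved I a
  (transfer I a c) c ->
  base_weight s rk x (color_pow I) a c = 0.
Proof.
rewrite conserved_transferE; case: c => // k; rewrite negb_or -leqNgt leqn0 =>
  /andP[ne /eqP I0].
rewrite /base_weight /= I0 expr0 subrr !mulr0 (rk_eq rkI) in ne *.
by case: ltngtP ne; rewrite ?mulr0.
Qed.

Ltac abstract_pow S := let e := fresh "e" in
  move: S => e; have := expf_neq0 e q0; move: (q ^+ e) => ? ?.
Ltac crunch hx := rewrite /=; field; repeat (apply/andP; split); assumption.

Lemma LweightE x I a c : 1 - s * x != 0 ->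
  Lweight q s x I a (transfer I a c) c = flow_weight (@rank n) x I a c.
Proof.
move=> hx; rewrite /Lweight /flow_weight; case: ifPn => [h|_].
  by rewrite (base_weight_not_conserved (@rank_inj n)) ?mulr0.
rewrite /ltl /base_weight (rk_eq (@rank_inj n)); case: c => [[]i|].
- rewrite upper_rank_pos; abstract_pow (sum_le I (inl i)); rewrite /color_pow.
  move: (q ^+ I _) => u; case: ltngtP => _; crunch hx.
- rewrite upper_rank_neg; abstract_pow (sum_gt I (inr i)).
  rewrite /color_pow; move: (q ^+ I _) => u; case: ltngtP => _; crunch hx.
- rewrite upper_rank_zero /= sumv_split exprD.
  abstract_pow (sum_neg I); abstract_pow (sum_pos I).
  case: ltngtP => _; crunch hx.
Qed.

Lemma MweightE x I j l : 1 - s * x != 0 ->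
  Mweight q s x I j (transfer I j l) l = flow_weight (@rev_rank n) x I j l.
Proof.
move=> hx; rewrite /Mweight /flow_weight; case: ifPn => [h|_].
  by rewrite (base_weight_not_conserved (@rev_rank_inj n)) ?mulr0.
rewrite /ltl /base_weight (rk_eq (@rank_inj n)) !rev_rank_lt; case: l => [[]i|].
- rewrite upper_rev_rank_pos; abstract_pow (sum_lt I (inl i)).
  rewrite /color_pow; move: (q ^+ I _) => u; case: ltngtP => _; crunch hx.
- rewrite upper_rev_rank_neg.
  (* For a negative color the weight with [j = l] contains [sum_gt] and the other two contain
     [sum_ge]; all are expressed by [sum_gt]. *)
  have -> : sum_ge I (inr i) = (I (inr i) + sum_gt I (inr i))%N.
    rewrite /sum_ge /sumv (bigD1 (inr i)) /lel //=; congr addn.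
    apply: eq_bigl => k; rewrite /ltl ltn_neqAle andbC; congr (_ && _).
    by rewrite (inj_eq (@rank_inj n)) (inj_eq (@Some_inj _)) eq_sym.
  rewrite /color_pow exprD; abstract_pow (sum_gt I (inr i)).
  have := expf_neq0 (I (inr i)) q0; move: (q ^+ I (inr i)) => u u0.
  case: ltngtP => _; crunch hx.
- rewrite upper_rev_rank_zero /= sumv_split exprD.
  abstract_pow (sum_pos I); abstract_pow (sum_neg I); case: ltngtP => _; crunch hx.
Qed.
End Weights.

Lemma rmat_support (F : fieldType) (T : finType) (rk : T -> nat)
    (e dl ol dg og : F) (u v u' v' : T) :
  rmat rk e dl ol dg og u v u' v' != 0 ->
  (u' = u /\ v' = v) \/ (u' = v /\ v' = u).
Proof.
case: (altP (u' =P u)) => h1; case: (altP (v' =P v)) => h2;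
case: (altP (u' =P v)) => h3; case: (altP (v' =P u)) => h4;
  rewrite /rmat ?(negPf h1) ?(negPf h2) ?(negPf h3) ?(negPf h4)
    ?andbF /= ?mulr0n ?addr0 ?if_same ?eqxx //; auto.
Qed.

(** * Yang-Baxter equations for a column of two vertices *)

Section Columns.
Variables (F : fieldType) (q s : F) (n : nat).
Hypotheses (q0 : q != 0) (s0 : s != 0).
Implicit Types (a b c d j l : label n) (I : cvec n) (x y : F).

Lemma sumv_transfer I a c : conserved I a (transfer I a c) c ->
  (sumv (transfer I a c) predT + (c != None) = sumv I predT + (a != None))%N.
Proof.
have sev b : (\sum_k evec b k = (b != None) :> nat)%N.
  case: b => [k0|]; last by rewrite big1 // => k _; rewrite evecE.
  rewrite (bigD1 k0) //= evecE eqxx big1 // => k /negPf h.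
  by rewrite evecE (inj_eq (@Some_inj _)) eq_sym h.
move=> /forallP h; rewrite -!sev /sumv -!big_split /=.
by apply: eq_bigr => k _; rewrite -(eqP (h k)).
Qed.

Lemma color_pow_transfer I a c : conserved I a (transfer I a c) c ->
  color_pow q s (transfer I a c) = shift q (color_pow q s I) a c.
Proof.
move=> h; apply/funext => -[k|]; rewrite /shift /=.
  move/forallP/(_ k)/eqP: h; rewrite !evecE (eq_sym _ a) (eq_sym _ c) => h.
  by rewrite -exprD h exprD mulfK ?expf_neq0.
have := sumv_transfer h; rewrite !(eq_sym None) => /(congr1 (fun m => q ^+ m)).
have e0 m : q ^+ m != 0 by rewrite expf_neq0.
move: (sumv _ _) (sumv _ _) => m m'; case: eqP => _; case: eqP => _ /=;
  rewrite ?addn0 ?addn1 ?exprS ?expr0 ?mulr1 ?divr1.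
- by move=> ->; rewrite mulfK.
- by move=> ->; move: (e0 m); move: (q ^+ m) => u u0; field; rewrite u0 q0 s0.
- by move=> <-; move: (e0 m'); move: (q ^+ m') => u u0; field; rewrite u0 q0 s0.
- by move=> /(mulfI q0) ->.
Qed.

(** Symmetric in the entering and in the leaving labels, and unaffected by a label that both enters
    and leaves; hence the top vector is the same in all terms of a Yang-Baxter sum. *)
Definition transfer2 I a b c d : cvec n :=
  [ffun k => (I k + evec a k + evec b k - (evec c k + evec d k))%N].

Lemma transfer_transfer I a c b d : conserved I a (transfer I a c) c ->
  transfer (transfer I a c) b d = transfer2 I a b c d.
Proof.
move=> /forallP h; apply/ffunP => k; have /eqP := h k; rewrite !ffunE.
by lia.
Qed.

Lemma flow_weight_comp rk1 rk2 x y I a c b d (g : cvec n -> F) : injective rk1 ->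
  flow_weight q s rk1 x I a c * (flow_weight q s rk2 y (transfer I a c) b d * g
    (transfer (transfer I a c) b d)) =
  s / (1 - s * x) * (s / (1 - s * y)) *
  (base_weight s rk1 x (color_pow q s I) a c * base_weight s rk2 y (shift q
    (color_pow q s I) a c) b d) *
  g (transfer2 I a b c d).
Proof.
move=> rkI; rewrite /flow_weight; set k1 := s / (1 - s * x); set k2 := s / (1 - s *
  y).
case: (boolP (conserved I a (transfer I a c) c)) => h.
  by rewrite (transfer_transfer _ _ h) (color_pow_transfer h); ring.
by rewrite base_weight_not_conserved // !(mulr0, mul0r).
Qed.

(** [g] stands for everything above the two vertices. Its argument is the same wherever the crossing
    weight is nonzero, so it factors out and [base_weight_ybe] remains. *)
Lemma col_same rk x y I a b c d (g : cvec n -> F) : injective rk ->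
  \sum_a' \sum_b' rsame q rk x y a b a' b' *
    (flow_weight q s rk x I a' c *
      (flow_weight q s rk y (transfer I a' c) b' d * g (transfer (transfer I a' c) b'
        d))) =
  \sum_c' \sum_d' flow_weight q s rk y I b d' *
      (flow_weight q s rk x (transfer I b d') a c' * g (transfer (transfer I b d') a
        c')) *
    rsame q rk x y c' d' c d.
Proof.
move=> rkI; set k := s / (1 - s * x) * (s / (1 - s * y)) * g (transfer2 I a b c d).
transitivity (k * \sum_a' \sum_b' rsame q rk x y a b a' b' *
    (base_weight s rk x (color_pow q s I) a' c * base_weight s rk y (shift q
      (color_pow q s I) a' c) b' d)).
  rewrite mulr_sumr; apply: eq_bigr => a' _; rewrite mulr_sumr.
  apply: eq_bigr => b' _; rewrite flow_weight_comp //.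
  case: (eqVneq (rsame q rk x y a b a' b') 0) => [->|]; first by rewrite !mul0r mulr0.
  move=> /rmat_support[][-> ->]; rewrite /k; first by ring.
  have -> : transfer2 I b a c d = transfer2 I a b c d by apply/ffunP => e; rewrite
    !ffunE; lia.
  by ring.
rewrite (base_weight_ybe s rkI q0) mulr_sumr; apply: eq_bigr => c' _; rewrite
  mulr_sumr.
apply: eq_bigr => d' _; rewrite flow_weight_comp //.
case: (eqVneq (rsame q rk x y c' d' c d) 0) => [->|]; first by rewrite !mulr0.
move=> /rmat_support[][<- <-]; rewrite /k.
  have -> : transfer2 I b a d c = transfer2 I a b c d by apply/ffunP => e; rewrite
    !ffunE; lia.
  by ring.
have -> : transfer2 I b a c d = transfer2 I a b c d by apply/ffunP => e; rewrite
  !ffunE; lia.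
by ring.
Qed.

Lemma col_mixed x y I a l c j (g : cvec n -> F) :
  \sum_l' \sum_a' rmix q (@rank n) (x * y) a l' a' l *
    (flow_weight q s (@rev_rank n) y I j l' *
      (flow_weight q s (@rank n) x (transfer I j l') a' c * g (transfer (transfer I j
        l') a' c))) =
  \sum_j' \sum_c' flow_weight q s (@rank n) x I a c' *
      (flow_weight q s (@rev_rank n) y (transfer I a c') j' l * g (transfer (transfer
        I a c') j' l)) *
    rmix q (@rank n) (x * y) c' j c j'.
Proof.
have rkI := @rank_inj n; have rev_rankI := @rev_rank_inj n.
set k := s / (1 - s * x) * (s / (1 - s * y)) * g (transfer2 I j a l c).
transitivity (k * \sum_l' \sum_a' rmix q (@rank n) (x * y) a l' a' l *
    (base_weight s (@rev_rank n) y (color_pow q s I) j l' *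
     base_weight s (@rank n) x (shift q (color_pow q s I) j l') a' c)).
  rewrite mulr_sumr; apply: eq_bigr => l' _; rewrite mulr_sumr.
  apply: eq_bigr => a' _; rewrite flow_weight_comp //.
  case: (eqVneq (rmix q (@rank n) (x * y) a l' a' l) 0) => [->|].
    by rewrite !mul0r mulr0.
  move=> /rmat_support; rewrite /k => -[[-> <-]|[-> ->]]; first by ring.
  have -> : transfer2 I j l' l' c = transfer2 I j a a c by apply/ffunP => e; rewrite
    !ffunE; lia.
  by ring.
rewrite (mixed_ybe q0 s0 rkI rev_rankI (@rev_rank_lt n)); first last.
- by move=> m; apply: color_pow_neq0.
- exact: color_pow_prod.
rewrite exchange_big /= mulr_sumr; apply: eq_bigr => j' _; rewrite mulr_sumr.
apply: eq_bigr => c' _; rewrite flow_weight_comp //.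
case: (eqVneq (rmix q (@rank n) (x * y) c' j c j') 0) => [->|]; first by rewrite
  !mulr0.
move=> /rmat_support; rewrite /k => -[[<- ->]|[-> ->]].
  have -> : transfer2 I a j c l = transfer2 I j a l c by apply/ffunP => e; rewrite
    !ffunE; lia.
  by ring.
have -> : transfer2 I a c' c' l = transfer2 I j a l j by apply/ffunP => e; rewrite
  !ffunE; lia.
by ring.
Qed.
End Columns.

(** * Rows *)

Section Rows.
Variables (F : fieldType) (T : finType) (V : Type).
Implicit Types (w : V -> T -> T -> F) (m : V -> T -> T -> V) (g : seq V -> F).

(* The head of [Is] is the rightmost column; [a] is the label of the left end of
   the row and [c] that of the right end. *)
Fixpoint row_op w m (Is : seq V) (a c : T) g : F :=
  if Is is J :: Is' then
    \sum_e w J e c * row_op w m Is' a e (fun Ks => g (m J e c :: Ks))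
  else g [::] *+ (a == c).

Lemma eq_row_op w m Is a c g g' : g =1 g' -> row_op w m Is a c g = row_op w m Is a c
  g'.
Proof.
elim: Is a c g g' => [|I Is IH] a c g g' h /=; first by rewrite h.
by apply: eq_bigr => e _; congr (_ * _); apply: IH => Ks; rewrite h.
Qed.

Lemma row_op_scale w m Is a c k g :
  row_op w m Is a c (fun Ks => k * g Ks) = k * row_op w m Is a c g.
Proof.
elim: Is a c g => [|I Is IH] a c g /=; first by rewrite mulrnAr.
by rewrite mulr_sumr; apply: eq_bigr => e _; rewrite IH mulrCA.
Qed.

Lemma row_op_sum w m Is a c (J : finType) (g : J -> seq V -> F) :
  row_op w m Is a c (fun Ks => \sum_j g j Ks) = \sum_j row_op w m Is a c (g j).
Proof.
elim: Is a c g => [|I Is IH] a c g /=; first by rewrite sumrMnl.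
rewrite exchange_big /=; apply: eq_bigr => e _.
by rewrite IH mulr_sumr.
Qed.

Lemma row_op_linear w m Is a c k1 k2 g1 g2 :
  row_op w m Is a c (fun Ks => k1 * g1 Ks + k2 * g2 Ks) =
  k1 * row_op w m Is a c g1 + k2 * row_op w m Is a c g2.
Proof.
rewrite -!row_op_scale; transitivity (row_op w m Is a c (fun Ks =>
    \sum_(i : bool) (if i then k1 * g1 Ks else k2 * g2 Ks))).
  by apply: eq_row_op => Ks; rewrite big_bool.
by rewrite row_op_sum big_bool.
Qed.

Definition two_rows w1 m1 w2 m2 Is (a b c d : T) g : F :=
  row_op w1 m1 Is a c (fun Ks => row_op w2 m2 Ks b d g).

Lemma two_rows_cons w1 m1 w2 m2 I Is a b c d g :
  two_rows w1 m1 w2 m2 (I :: Is) a b c d g =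
  \sum_e \sum_f w1 I e c * (w2 (m1 I e c) f d *
    two_rows w1 m1 w2 m2 Is a b e f (fun Ks => g (m2 (m1 I e c) f d :: Ks))).
Proof.
rewrite /two_rows /=; apply: eq_bigr => e _; rewrite row_op_sum mulr_sumr.
by apply: eq_bigr => f _; rewrite row_op_scale.
Qed.

Variables (X : T -> T -> T -> T -> F).
Variables (wA wB : V -> T -> T -> F) (mA mB : V -> T -> T -> V).

(** A crossing that can be moved through one column can be moved through the whole row, by
    induction: first through all columns but the rightmost one, then through that one. *)
Lemma train_argument :
  (forall I a b c d (g : V -> F),
    \sum_a' \sum_b' X a b a' b' *
      (wA I a' c * (wB (mA I a' c) b' d * g (mB (mA I a' c) b' d))) =
    \sum_c' \sum_d' wB I b d' *
      (wA (mB I b d') a c' * g (mA (mB I b d') a c')) * X c' d' c d) ->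
  forall Is a b c d g,
    \sum_a' \sum_b' X a b a' b' * two_rows wA mA wB mB Is a' b' c d g =
    \sum_c' \sum_d' two_rows wB mB wA mA Is b a d' c' g * X c' d' c d.
Proof.
move=> col; elim=> [|I Is IH] a b c d g.
  rewrite /two_rows /= (bigD1 c) //= (bigD1 d) //= !eqxx !mulr1n.
  rewrite [X in _ + X + _]big1 ?addr0; last first.
    by move=> i /negPf->; rewrite mulr0n mul0rn mulr0.
  rewrite [X in _ + X]big1 ?addr0; last first.
    by move=> i /negPf->; rewrite big1 // => j _; rewrite mulr0n mulr0.
  rewrite [RHS](bigD1 a) //= [in RHS](bigD1 b) //= !eqxx !mulr1n.
  rewrite [X in _ = _ + X + _]big1 ?addr0; last first.
    by move=> i; rewrite eq_sym => /negPf->; rewrite mulr0n mul0r.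
  rewrite [X in _ = _ + X]big1 ?addr0 1?mulrC // => i; rewrite eq_sym => /negPf->.
  by rewrite big1 // => j _; rewrite mulr0n mul0rn mul0r.
transitivity (\sum_e \sum_f wA I e c * (wB (mA I e c) f d *
   \sum_a' \sum_b' X a b a' b' * two_rows wA mA wB mB Is a' b' e f
     (fun Ks => g (mB (mA I e c) f d :: Ks)))).
  under eq_bigr => a' _ do under eq_bigr => b' _ do rewrite two_rows_cons mulr_sumr.
  under eq_bigr => a' _ do rewrite exchange_big /=.
  rewrite exchange_big /=; apply: eq_bigr => e _.
  under eq_bigr => a' _ do under eq_bigr => b' _ do rewrite mulr_sumr.
  under eq_bigr => a' _ do rewrite exchange_big /=.
  rewrite exchange_big /=; apply: eq_bigr => f _.
  rewrite !mulr_sumr; apply: eq_bigr => a' _; rewrite !mulr_sumr.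
  by apply: eq_bigr => b' _; ring.
under eq_bigr => e _ do under eq_bigr => f _ do rewrite IH.
(* The crossing now stands just left of the rightmost column. The sums are collected so that [col]
   applies, the remaining columns being part of its continuation. *)
transitivity (\sum_c' \sum_d' \sum_e \sum_f X c' d' e f * (wA I e c *
    (wB (mA I e c) f d *
     two_rows wB mB wA mA Is b a d' c' (fun Ks => g (mB (mA I e c) f d :: Ks))))).
  under [RHS]eq_bigr => c' _ do rewrite exchange_big /=.
  rewrite [RHS]exchange_big /=; apply: eq_bigr => e _.
  under [RHS]eq_bigr => c' _ do rewrite exchange_big /=.
  rewrite [RHS]exchange_big /=; apply: eq_bigr => f _.
  rewrite !mulr_sumr; apply: eq_bigr => c' _; rewrite !mulr_sumr.
  by apply: eq_bigr => d' _; ring.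
under eq_bigr => c' _ do under eq_bigr => d' _ do
  rewrite (col I c' d' c d
    (fun K => two_rows wB mB wA mA Is b a d' c' (fun Ks => g (K :: Ks)))).
under eq_bigr => c' _ do rewrite exchange_big /=.
rewrite exchange_big /=; apply: eq_bigr => c'' _.
under eq_bigr => c' _ do rewrite exchange_big /=.
rewrite exchange_big /=; apply: eq_bigr => d'' _.
rewrite two_rows_cons mulr_suml exchange_big /=; apply: eq_bigr => e _.
by rewrite mulr_suml.
Qed.
End Rows.

(** * The reflection equation *)

Section Reflection.
Variables (F : fieldType) (n : nat) (q qh nu t : F).
Implicit Types (a b c d : label n) (f : label n -> label n -> F).

Definition rmat_app (rk : label n -> nat) (e dl ol dg og : F) u v f : F :=
  if (rk u < rk v)%N then dl * f u v + ol * f v u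
  else if (rk v < rk u)%N then dg * f u v + og * f v u else e * f u v.

Definition cap_app (p : F) a (h : label n -> F) : F :=
  match a with
  | None => h None
  | Some (inl i) => t * p * h (Some (inr i)) + (1 - t * p) * h (Some (inl i))
  | Some (inr i) => p * h (Some (inl i)) + (1 - p) * h (Some (inr i))
  end.

Lemma sum_cap x a (h : label n -> F) :
  \sum_b Cweight qh nu t x a b * h b = cap_app (phi nu t (qh^-1 * x^-1)) a h.
Proof.
have two_terms (u v : label n) (k : label n -> F) : u != v ->
    (forall b, b != u -> b != v -> k b = 0) -> \sum_b k b = k u + k v.
  move=> uv h0; rewrite (bigD1 u) //= (bigD1 v) 1?eq_sym //= big1 ?addr0 //.
  by move=> b /andP[bu bv]; exact: h0.
case: a => [[]i|] /=.
- rewrite (@two_terms (Some (inr i)) (Some (inl i))) //= ?eqxx //.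
  move=> [[]j|] /= h1 h2; rewrite ?mul0r //; case: eqP => [e|]; rewrite ?mul0r //;
    subst j.
    by rewrite eqxx in h2.
  by rewrite eqxx in h1.
- rewrite (@two_terms (Some (inl i)) (Some (inr i))) //= ?eqxx //.
  move=> [[]j|] /= h1 h2; rewrite ?mul0r //; case: eqP => [e|]; rewrite ?mul0r //;
    subst j.
    by rewrite eqxx in h1.
  by rewrite eqxx in h2.
- rewrite (bigD1 None) //= mul1r big1 ?addr0 // => -[b|] //= _.
  by rewrite mul0r.
Qed.

Definition rmix_app (z : F) :=
  rmat_app (@rank n) (q * (1 - z)) (q * (1 - q * z)) (q * (q - 1) * z)
    (1 - q * z) (q - 1).

Definition rdiag_app rk (x y : F) :=
  rmat_app rk (x - q * y) (q * (x - y)) ((1 - q) * x) (x - y) ((1 - q) * y).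

(** The right boundary once both Gamma rows lie below both Delta rows: the lower Gamma label [c]
    turns at its cap, the resulting Delta line crosses the Gamma line [c'], and then that line turns
    at its cap. [f] receives the labels of the lower and of the upper Delta row. *)
Definition double_cap (p1 p2 z : F) c c' f : F :=
  cap_app p1 c (fun d => rmix_app z c' d (fun e j => cap_app p2 e (fun g => f j g))).

Lemma rmat_app_lt rk e dl ol dg og u v f : (rk u < rk v)%N ->
  rmat_app rk e dl ol dg og u v f = dl * f u v + ol * f v u.
Proof. by rewrite /rmat_app => ->. Qed.

Lemma rmat_app_gt rk e dl ol dg og u v f : (rk v < rk u)%N ->
  rmat_app rk e dl ol dg og u v f = dg * f u v + og * f v u.
Proof. by rewrite /rmat_app => h; rewrite h ltnNge (ltnW h). Qed.

Lemma rmat_app_eq rk e dl ol dg og u f : rmat_app rk e dl ol dg og u u f = e * f u u.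
Proof. by rewrite /rmat_app ltnn. Qed.

(** Numerator and denominator of [phi] are multiplied by [q x^2], which makes the cap weights
    quotients of polynomials in [x]. *)
Lemma phi_cap x : qh ^+ 2 = q -> qh != 0 -> nu != 0 -> x != 0 ->
  1 - nu * t * (qh^-1 * x^-1) != 0 -> 1 + nu^-1 * (qh^-1 * x^-1) != 0 ->
  let D := q * x ^+ 2 + qh * (nu^-1 - nu * t) * x - t in
  D != 0 /\ phi nu t (qh^-1 * x^-1) = (q * x ^+ 2 - 1) / D.
Proof.
move=> <- qh0 nu0 x0 h1 h2 D.
have DE : D = qh ^+ 2 * x ^+ 2 *
    ((1 - nu * t * (qh^-1 * x^-1)) * (1 + nu^-1 * (qh^-1 * x^-1))).
  by rewrite /D; field; rewrite qh0 nu0 x0.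
have D0 : D != 0 by rewrite DE !mulf_neq0 ?expf_neq0.
split=> //; rewrite /phi; apply: (canLR (mulfK _)); first by rewrite mulf_neq0.
rewrite mulrAC; apply: (canRL (mulfK D0)); rewrite DE; field.
by rewrite qh0 x0.
Qed.

Ltac ev := rewrite /double_cap /=;
  repeat (match goal with |- context [rmat_app ?rk ?e ?dl ?ol ?dg ?og ?u ?v ?g] =>
   first [rewrite (@rmat_app_lt rk e dl ol dg og u v g);
            last by (rewrite ?rev_rank_lt /=; lia)
         |rewrite (@rmat_app_gt rk e dl ol dg og u v g);
            last by (rewrite ?rev_rank_lt /=; lia)
         |rewrite (@rmat_app_eq rk e dl ol dg og u g)] end; rewrite /=).

(* By [phi_cap], [k] is [qh * (nu^-1 - nu * t)]. *)
Lemma reflection x y k c d f :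
  q * x ^+ 2 + k * x - t != 0 -> q * y ^+ 2 + k * y - t != 0 ->
  let px := (q * x ^+ 2 - 1) / (q * x ^+ 2 + k * x - t) in
  let py := (q * y ^+ 2 - 1) / (q * y ^+ 2 + k * y - t) in
  rdiag_app (@rank n) y x c d (fun c' d' => double_cap py px (x * y) c' d' f) =
  double_cap px py (x * y) d c (fun v u => rdiag_app (@rev_rank n) y x u v f).
Proof.
move=> hx hy px py.
rewrite /rdiag_app /double_cap /rmix_app.
(* Caps only pass between a color and its bar and crossings only permute, so finitely many
   configurations remain: the kinds of [c] and [d] and the order of [i] and [j]. *)
case: c => [[]i|]; case: d => [[]j|];
  try (have ? := ltn_ord i); try (have ? := ltn_ord j);
  try (have [hij|hij|/val_inj hij] := ltngtP i j; last subst j);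
  ev; rewrite /px /py; field; by rewrite ?hx ?hy.
Qed.
End Reflection.

(** * Exchange relation for capped pairs of rows *)

Section PairOperator.
Variables (F : fieldType) (q qh s nu t : F) (n : nat).
Hypotheses (q0 : q != 0) (s0 : s != 0) (nu0 : nu != 0) (hqh : qh ^+ 2 = q).
Implicit Types (x y : F) (a b c d : label n) (Is : seq (cvec n)).

Let rk := @rank n.
Let rrk := @rev_rank n.

Definition gamma_op x := row_op (flow_weight q s rk x) (@transfer n).
(* Colors travel leftwards in a Delta row: the incoming label is on the right. *)
Definition delta_op x :=
  row_op (fun I l r => flow_weight q s rrk x I r l) (fun I l r => transfer I r l).

(** The operator [P_x(a)] of the overview. [g] is a function of the vertical labels above the pair,
    the result one of those below it. *)
Definition double_row x a (g : seq (cvec n) -> F) Is : F :=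
  \sum_c gamma_op x Is a c (fun Ks =>
    \sum_d Cweight qh nu t x c d * delta_op x Ks None d g).

Definition delta_delta_op x y Ks (u v : label n) g : F :=
  delta_op x Ks None u (fun Js => delta_op y Js None v g).

Lemma gamma_op_exchange x y Is a b c d g :
  \sum_a' \sum_b' rsame q rk x y a b a' b' *
     gamma_op x Is a' c (fun Ks => gamma_op y Ks b' d g) =
  \sum_c' \sum_d' gamma_op y Is b d' (fun Ks => gamma_op x Ks a c' g) *
     rsame q rk x y c' d' c d.
Proof.
apply: (train_argument (X := rsame q rk x y)) => I a' b' c' d' h.
exact: (col_same q0 s0 _ _ _ _ _ _ _ _ (@rank_inj n)).
Qed.

(** Both rows carry 0 at the left end, where the crossing is therefore the scalar [x - q * y]. *)
Lemma delta_op_exchange x y Ks (u v : label n) g :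
  (x - q * y) * delta_delta_op y x Ks u v g =
  rdiag_app q rrk x y v u (fun u' v' => delta_delta_op x y Ks u' v' g).
Proof.
have := @train_argument _ _ _ (fun a b a' b' => rsame q rrk x y b' a' b a)
  (fun I l r => flow_weight q s rrk y I r l) (fun I l r => flow_weight q s rrk x I r
    l)
  (fun I l r => transfer I r l) (fun I l r => transfer I r l) _ Ks None None u v g.
rewrite -/(delta_op x) -/(delta_op y) exchange_big /=.
under eq_bigr => b' _ do under eq_bigr => a' _ do rewrite mulrC.
rewrite (sum_rmat_tr (@rev_rank_inj n)) ltnn => -> => [|I a b c d h].
  rewrite exchange_big /= /rdiag_app /rmat_app.
  under eq_bigr => b' _ do under eq_bigr => a' _ do rewrite mulrC.
  by rewrite sum_rmat.
(* Labels run leftwards in Delta rows, so the two ends change roles: the column equation is used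
   from right to left, with the labels in reverse order. *)
have E := @col_same _ q s n q0 s0 rrk x y I d c b a h (@rev_rank_inj n).
rewrite [LHS]exchange_big [RHS]exchange_big /=.
under eq_bigr => b' _ do under eq_bigr => a' _ do rewrite mulrC.
under [RHS]eq_bigr => b' _ do under eq_bigr => a' _ do rewrite mulrC.
exact: esym E.
Qed.

(** At the left end the Delta row carries 0 and the Gamma row a color, so the crossing is forced; it
    is the scalar on the left, whose power of [q] records whether [a] is below 0. *)
Lemma delta_gamma_op_exchange x y Is (a : scolor n) (c j : label n) g :
  q ^+ is_pos a * (1 - q * (x * y)) *
    delta_op y Is None j (fun Ks => gamma_op x Ks (Some a) c g) =
  \sum_c' \sum_j' gamma_op x Is (Some a) c' (fun Ks => delta_op y Ks None j' g) *
     rmix q rk (x * y) c' j c j'.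
Proof.
have := @train_argument _ _ _ (fun l a l' a' => rmix q rk (x * y) a l' a' l)
  (fun I l r => flow_weight q s rrk y I r l) (flow_weight q s rk x)
  (fun I l r => transfer I r l) (@transfer n) _ Is None (Some a) j c g.
rewrite /two_rows -/(gamma_op x) -/(delta_op y) (sum_rmat_out (@rank_inj n))
  exchange_big /= => <-.
  by case: a => a /=; have ? := ltn_ord a; case: ltngtP; try lia; rewrite ?mul1r.
move=> I l b j' c' h; exact: col_mixed.
Qed.

Let px x := phi nu t (qh^-1 * x^-1).

Lemma row_op_cap_app w m Is a c p (b : label n) (h : label n -> seq (cvec n) -> F) :
  row_op w m Is a c (fun Ks => cap_app t p b (fun d => h d Ks)) =
  cap_app t p b (fun d => row_op w m Is a c (h d)).
Proof.
by case: b => [[]i|] /=; rewrite ?row_op_linear.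
Qed.

Lemma eq_cap_app p (b : label n) (h h' : label n -> F) : h =1 h' -> cap_app t p b h =
  cap_app t p b h'.
Proof. by move=> e; case: b => [[]i|] /=; rewrite !e. Qed.

Lemma cap_app_sum (J : finType) p (b : label n) (h : label n -> J -> F) :
  cap_app t p b (fun d => \sum_j h d j) = \sum_j cap_app t p b (h^~ j).
Proof.
by case: b => [[]i|] /=; rewrite // !mulr_sumr -big_split.
Qed.

Lemma cap_app_scale k p (b : label n) (h : label n -> F) :
  cap_app t p b (fun d => k * h d) = k * cap_app t p b h.
Proof. by case: b => [[]i|] /=; rewrite // mulrDr !(mulrCA k). Qed.

Lemma rmat_app_scale r e dl ol dg og k (u v : label n) (f : label n -> label n -> F) :
  rmat_app r e dl ol dg og u v (fun a b => k * f a b) = k * rmat_app r e dl ol dg og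
    u v f.
Proof. by rewrite /rmat_app; case: ifP => _; [|case: ifP => _]; ring. Qed.

Lemma eq_rmat_app r e dl ol dg og (u v : label n) (f f' : label n -> label n -> F) :
  f =2 f' -> rmat_app r e dl ol dg og u v f = rmat_app r e dl ol dg og u v f'.
Proof. by move=> h; rewrite /rmat_app !h. Qed.

Lemma double_rowE x a g Is : double_row x a g Is =
  \sum_c gamma_op x Is a c (fun Ks => cap_app t (px x) c (fun d => delta_op x Ks None
    d g)).
Proof.
apply: eq_bigr => c _; apply: eq_row_op => Ks; exact: sum_cap.
Qed.

(** Only the two middle rows, Delta with [y] and Gamma with [x], are exchanged; their crossing comes
    out at the right end, between the two caps of [double_cap]. *)
Lemma double_row_double_row x y (a b : scolor n) g Is :
  q ^+ is_pos a * (1 - q * (x * y)) *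
    double_row y (Some b) (double_row x (Some a) g) Is =
  \sum_c \sum_c' gamma_op y Is (Some b) c (fun Ks =>
    gamma_op x Ks (Some a) c' (fun Ms =>
      double_cap q t (px y) (px x) (x * y) c c'
        (fun u v => delta_delta_op y x Ms u v g))).
Proof.
rewrite double_rowE mulr_sumr; apply: eq_bigr => c _.
rewrite -row_op_scale -row_op_sum; apply: eq_row_op => Ks; rewrite -cap_app_scale.
transitivity (cap_app t (px y) c (fun d =>
    \sum_c' gamma_op x Ks (Some a) c' (fun Ms =>
      rmix_app q (x * y) c' d (fun e j =>
        cap_app t (px x) e (fun f => delta_delta_op y x Ms j f g)))));
  last first.
  rewrite cap_app_sum; apply: eq_bigr => c' _; rewrite -row_op_cap_app.
  exact: eq_row_op.
apply: eq_cap_app => d.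
transitivity (\sum_e q ^+ is_pos a * (1 - q * (x * y)) *
  delta_op y Ks None d (fun Ms => gamma_op x Ms (Some a) e (fun Js =>
    cap_app t (px x) e (fun f => delta_op x Js None f g)))).
  rewrite -mulr_sumr -row_op_sum; congr (_ * _);
  apply: eq_row_op => Ms; exact: double_rowE.
under eq_bigr => e _ do rewrite delta_gamma_op_exchange.
rewrite exchange_big /=; apply: eq_bigr => c' _.
transitivity (\sum_e \sum_j rmix q rk (x * y) c' d e j * gamma_op x Ks (Some a) c'
    (fun Ms => cap_app t (px x) e (fun f => delta_delta_op y x Ms j f g))).
  apply: eq_bigr => e _; apply: eq_bigr => j _; rewrite mulrC; congr (_ * _).
  apply: eq_row_op => Ms; rewrite -row_op_cap_app; exact: eq_row_op.
under eq_bigr => e _ do under eq_bigr => j _ do rewrite -row_op_scale.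
under eq_bigr => e _ do rewrite -row_op_sum.
rewrite -row_op_sum; apply: eq_row_op => Ms; exact: sum_rmat.
Qed.

Theorem double_row_exchange_generic x y (a b : scolor n) g Is :
  ltl (Some a) (Some b) -> x != 0 -> y != 0 -> 1 - q * (x * y) != 0 ->
  1 - nu * t * (qh^-1 * x^-1) != 0 -> 1 + nu^-1 * (qh^-1 * x^-1) != 0 ->
  1 - nu * t * (qh^-1 * y^-1) != 0 -> 1 + nu^-1 * (qh^-1 * y^-1) != 0 ->
  q * (y - x) * q ^+ is_pos b * double_row y (Some a) (double_row x (Some b) g) Is +
  (1 - q) * y * q ^+ is_pos a * double_row y (Some b) (double_row x (Some a) g) Is =
  (y - q * x) * q ^+ is_pos a * double_row x (Some b) (double_row y (Some a) g) Is.
Proof.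
move=> ab x0 y0 z0 hx1 hx2 hy1 hy2.
have qh0 : qh != 0 by move: q0; rewrite -hqh expf_eq0.
have [Dx Px] := phi_cap hqh qh0 nu0 x0 hx1 hx2.
have [Dy Py] := phi_cap hqh qh0 nu0 y0 hy1 hy2.
apply: (mulfI z0).
have YYab := double_row_double_row x y b a g Is; have YYba := double_row_double_row x
  y a b g Is.
have XXba := double_row_double_row y x a b g Is.
rewrite (mulrC y x) in XXba.
transitivity (q * (y - x) * (q ^+ is_pos b * (1 - q * (x * y)) *
    double_row y (Some a) (double_row x (Some b) g) Is) +
  (1 - q) * y * (q ^+ is_pos a * (1 - q * (x * y)) *
    double_row y (Some b) (double_row x (Some a) g) Is)); first by ring.
transitivity ((y - q * x) * (q ^+ is_pos a * (1 - q * (x * y)) *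
  double_row x (Some b) (double_row y (Some a) g) Is)); last by ring.
rewrite YYab YYba XXba.
pose h c c' Ms :=
  double_cap q t (px y) (px x) (x * y) c c' (fun u v => delta_delta_op y x Ms u v g).
(* As [a < b], the crossing of the left labels has two terms, with the coefficients [q * (y - x)]
   and [(1 - q) * y] of the claim. *)
transitivity (\sum_c \sum_c' \sum_a' \sum_b' rsame q rk y x (Some a) (Some b) a' b' *
    gamma_op y Is a' c (fun Ks => gamma_op x Ks b' c' (h c c'))).
  rewrite !mulr_sumr -big_split; apply: eq_bigr => c _.
  rewrite !mulr_sumr -big_split; apply: eq_bigr => c' _.
  by rewrite sum_rmat /rk [(_ < _)%N]ab.
under eq_bigr => c _ do under eq_bigr => c' _ do rewrite gamma_op_exchange.
(* The crossing has passed both Gamma rows; it is brought inside their operators to act on the right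
   boundary [h]. *)
transitivity (\sum_d1 \sum_c1 gamma_op x Is (Some b) d1 (fun Ks =>
   gamma_op y Ks (Some a) c1 (fun Ms => \sum_c \sum_c' rsame q rk y x c1 d1 c c' * h
     c c' Ms))).
  transitivity (\sum_c1 \sum_d1 \sum_c \sum_c' rsame q rk y x c1 d1 c c' *
     gamma_op x Is (Some b) d1 (fun Ks => gamma_op y Ks (Some a) c1 (h c c'))).
    under eq_bigr => c _ do rewrite exchange_big /=.
    rewrite exchange_big /=; apply: eq_bigr => c1 _.
    under eq_bigr => c _ do rewrite exchange_big /=.
    rewrite exchange_big /=; apply: eq_bigr => d1 _.
    by apply: eq_bigr => c _; apply: eq_bigr => c' _; rewrite mulrC.
  rewrite exchange_big /=; apply: eq_bigr => d1 _; apply: eq_bigr => c1 _.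
  under eq_bigr => c _ do under eq_bigr => c' _ do rewrite -row_op_scale.
  under eq_bigr => c _ do rewrite -row_op_sum.
  rewrite -row_op_sum; apply: eq_row_op => Ks.
  under eq_bigr => c _ do under eq_bigr => c' _ do rewrite -row_op_scale.
  under eq_bigr => c _ do rewrite -row_op_sum.
  by rewrite -row_op_sum.
rewrite mulr_sumr; apply: eq_bigr => d1 _; rewrite mulr_sumr; apply: eq_bigr => c1 _.
rewrite -row_op_scale; apply: eq_row_op => Ks;
rewrite -row_op_scale; apply: eq_row_op => Ms.
(* [reflection] moves the crossing through the caps to the Delta rows, where [delta_op_exchange]
   turns it into the scalar [y - q * x]. *)
rewrite sum_rmat /h /px Px Py -[LHS]/(rdiag_app q rk y x c1 d1 (fun c c' => _)).
have := @reflection F n q t x y (qh * (nu^-1 - nu * t)) c1 d1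
  (fun u v => delta_delta_op y x Ms u v g) Dx Dy.
move=> ->.
rewrite /double_cap -cap_app_scale; apply: eq_cap_app => d.
rewrite /rmix_app -rmat_app_scale; apply: eq_rmat_app => e j.
by rewrite -cap_app_scale; apply: eq_cap_app => g0; rewrite delta_op_exchange.
Qed.
End PairOperator.

(** * The partition function as an iterated operator *)

Lemma big_tuple_cons (F : fieldType) (T : finType) m (f : seq T -> F) :
  \sum_(t : m.+1.-tuple T) f t = \sum_x \sum_(t : m.-tuple T) f (x :: t).
Proof.
pose h (p : T * m.-tuple T) : m.+1.-tuple T := [tuple of p.1 :: p.2].
have hb : bijective h.
  apply: inj_card_bij; last by rewrite card_prod !card_tuple expnS.
  by move=> [x t] [x' t'] /(congr1 val) /= [-> /val_inj ->].
rewrite (reindex h) /=; last exact: onW_bij.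
by rewrite pair_bigA.
Qed.

Lemma big_tuple_rcons (F : fieldType) (T : finType) m (f : seq T -> F) :
  \sum_(t : m.+1.-tuple T) f t = \sum_x \sum_(t : m.-tuple T) f (rcons t x).
Proof.
pose h (p : T * m.-tuple T) : m.+1.-tuple T := [tuple of rcons p.2 p.1].
have hb : bijective h.
  apply: inj_card_bij; last by rewrite card_prod !card_tuple expnS.
  by move=> [x t] [x' t'] /(congr1 val) /= /rcons_inj [/val_inj -> ->].
rewrite (reindex h) /=; last exact: onW_bij.
by rewrite pair_bigA.
Qed.

Lemma mkseqS (T : Type) (f : nat -> T) m :
  mkseq f m.+1 = f 0 :: mkseq (fun k => f k.+1) m.
Proof. by rewrite /mkseq /= -[1%N]/(1 + 0)%N iotaDl -map_comp. Qed.

Section RowExpansion.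
Variables (F : fieldType) (T : finType) (V : Type) (t0 : T).
Variables (w : V -> T -> T -> F) (m : V -> T -> T -> V).

(** The labels of a row from right to left form [c :: p], whose entry of index [L] is the left
    end. *)
Lemma row_op_mkseq L (v : nat -> V) a c (g : seq V -> F) :
  row_op w m (mkseq v L) a c g =
  \sum_(p : L.-tuple T) (nth t0 (c :: p) L == a)%:R *
    (\prod_(k < L) w (v k) (nth t0 (c :: p) k.+1) (nth t0 (c :: p) k)) *
    g (mkseq (fun k => m (v k) (nth t0 (c :: p) k.+1) (nth t0 (c :: p) k)) L).
Proof.
elim: L v c g => [|L IH] v c g.
  rewrite (big_pred1 [tuple]) => [|p]; last by case: p => -[].
  by rewrite big_ord0 mulr1 /= mulr_natl eq_sym.
rewrite mkseqS /= (@big_tuple_cons _ _ _ (fun p => (nth t0 (c :: p) L.+1 == a)%:R *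
    (\prod_(k < L.+1) w (v k) (nth t0 (c :: p) k.+1) (nth t0 (c :: p) k)) *
    g (mkseq (fun k => m (v k) (nth t0 (c :: p) k.+1) (nth t0 (c :: p) k)) L.+1))).
apply: eq_bigr => e _; rewrite IH mulr_sumr; apply: eq_bigr => p _.
by rewrite big_ord_recl mkseqS /=; ring.
Qed.
End RowExpansion.

Section Iterate.
Variables (F : fieldType) (q qh s nu t : F) (n L : nat).
Implicit Types (xx : nat -> F) (aa : nat -> label n) (v : nat -> cvec n).
Implicit Types (g : seq (cvec n) -> F) (R D : nat -> nat -> label n).

(* The topmost [k] pairs of rows. *)
Fixpoint double_rows xx aa g (k : nat) : seq (cvec n) -> F :=
  if k is k'.+1 then double_row q qh s nu t (xx k') (aa k') (double_rows xx aa g k')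
  else g.

Definition above_gamma R v k := fun c => transfer (v c) (R k c.+1) (R k c).
Definition above_delta D v k := fun c => transfer (v c) (D k c) (D k c.+1).

Definition double_row_weight xx aa R D v k : F :=
  (R k L == aa k)%:R * (D k L == None)%:R *
  Cweight qh nu t (xx k) (R k 0) (D k 0) *
  (\prod_(c < L) flow_weight q s (@rank n) (xx k) (v c) (R k c.+1) (R k c)) *
  (\prod_(c < L) flow_weight q s (@rev_rank n) (xx k) (above_gamma R v k c) (D k c)
    (D k c.+1)).

Fixpoint config_weight xx aa g R D (k : nat) v : F :=
  if k is k'.+1 then
    double_row_weight xx aa R D v k' * config_weight xx aa g R D k' (above_delta D
      (above_gamma R v k') k')
  else g (mkseq v L).

Notation rowT := (L.+1.-tuple (label n)).

Definition gamma_labels (ts : seq (rowT * rowT)) (k c : nat) : label n :=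
  nth None (nth ([tuple None | _ < L.+1], [tuple None | _ < L.+1]) ts k).1 c.
Definition delta_labels (ts : seq (rowT * rowT)) (k c : nat) : label n :=
  nth None (nth ([tuple None | _ < L.+1], [tuple None | _ < L.+1]) ts k).2 c.

Lemma double_row_mkseq x a g v :
  double_row q qh s nu t x a g (mkseq v L) =
  \sum_(p : rowT * rowT)
    double_row_weight (fun=> x) (fun=> a) (fun=> nth None p.1) (fun=> nth None p.2) v
      0 *
    g (mkseq (above_delta (fun=> nth None p.2) (above_gamma (fun=> nth None p.1) v 0)
      0) L).
Proof.
rewrite -(pair_bigA _ (fun p1 p2 : rowT => double_row_weight (fun=> x) (fun=> a)
  (fun=> nth None p1) (fun=> nth None p2) v 0 *
    g (mkseq (above_delta (fun=> nth None p2) (above_gamma (fun=> nth None p1) v 0)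
      0) L))) /=.
rewrite (@big_tuple_cons _ _ _ (fun p1 : seq (label n) => \sum_(p2 : rowT)
  double_row_weight (fun=> x) (fun=> a) (fun=> nth None p1) (fun=> nth None p2) v 0 *
    g (mkseq (above_delta (fun=> nth None p2) (above_gamma (fun=> nth None p1) v 0)
      0) L))).
apply: eq_bigr => c _; rewrite /gamma_op (row_op_mkseq None); apply: eq_bigr => p _.
rewrite (@big_tuple_cons _ _ _ (fun p2 : seq (label n) => double_row_weight (fun=> x)
  (fun=> a) (fun=> nth None (c :: p)) (fun=> nth None p2) v 0 *
    g (mkseq (above_delta (fun=> nth None p2) (above_gamma (fun=> nth None (c :: p))
      v 0) 0) L))).
rewrite mulr_sumr; apply: eq_bigr => d _; rewrite /delta_op (row_op_mkseq None)
  !mulr_sumr.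
apply: eq_bigr => p' _; rewrite /double_row_weight /above_delta /above_gamma; ring.
Qed.

Lemma eq_double_row_weight xx aa xx' aa' R D R' D' v v' k k' :
  xx k = xx' k' -> aa k = aa' k' ->
  (forall c, (c <= L)%N -> R k c = R' k' c /\ D k c = D' k' c) ->
  (forall c, (c < L)%N -> v c = v' c) ->
  double_row_weight xx aa R D v k = double_row_weight xx' aa' R' D' v' k'.
Proof.
move=> ex ea eRD ev; rewrite /double_row_weight ex ea.
have [-> _] := eRD L (leqnn L); have [_ ->] := eRD L (leqnn L).
have [-> ->] := eRD 0%N (leq0n L); congr (_ * _ * _).
  apply: eq_bigr => c _; rewrite ev //.
  by have [-> _] := eRD _ (ltn_ord c); have [-> _] := eRD _ (ltnW (ltn_ord c)).
apply: eq_bigr => c _; rewrite /above_gamma ev //.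
have [-> ->] := eRD _ (ltn_ord c).
by have [-> ->] := eRD _ (ltnW (ltn_ord c)).
Qed.

Lemma eq_above R D R' D' v v' k k' :
  (forall c, (c <= L)%N -> R k c = R' k' c /\ D k c = D' k' c) ->
  (forall c, (c < L)%N -> v c = v' c) ->
  forall c, (c < L)%N -> above_delta D (above_gamma R v k) k c = above_delta D'
    (above_gamma R' v' k') k' c.
Proof.
move=> eRD ev c cL; rewrite /above_delta /above_gamma ev //.
have [-> ->] := eRD _ cL.
by have [-> ->] := eRD _ (ltnW cL).
Qed.

Lemma eq_config_weight xx aa g R D R' D' k v v' :
  (forall j c, (j < k)%N -> (c <= L)%N -> R j c = R' j c /\ D j c = D' j c) ->
  (forall c, (c < L)%N -> v c = v' c) ->
  config_weight xx aa g R D k v = config_weight xx aa g R' D' k v'.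
Proof.
elim: k v v' => [|k IH] v v' eRD ev /=.
  congr g; apply: (@eq_from_nth _ (v 0%N)); rewrite !size_mkseq // => c cL.
  by rewrite !nth_mkseq // ev.
have eRDk c : (c <= L)%N -> R k c = R' k c /\ D k c = D' k c by exact: eRD.
rewrite (eq_double_row_weight (xx' := xx) (aa' := aa) (k' := k) _ _ eRDk ev) //;
  congr (_ * _).
apply: IH; first by move=> j c jk; apply: eRD; rewrite ltnS ltnW.
exact: eq_above.
Qed.

Lemma double_rows_mkseq xx aa g k v :
  double_rows xx aa g k (mkseq v L) =
  \sum_(ts : k.-tuple (rowT * rowT)) config_weight xx aa g (gamma_labels ts)
    (delta_labels ts) k v.
Proof.
elim: k v => [|k IH] v /=.
  by rewrite (big_pred1 [tuple]) // => p; case: p => -[].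
rewrite double_row_mkseq.
(* The recursion removes the lowest pair, which has the largest index; splitting the tuple at its
   end keeps the indices of the other pairs. *)
rewrite (@big_tuple_rcons _ _ _ (fun ts => double_row_weight xx aa (gamma_labels ts)
  (delta_labels ts) v k *
  config_weight xx aa g (gamma_labels ts) (delta_labels ts) k (above_delta
    (delta_labels ts) (above_gamma (gamma_labels ts) v k) k))).
apply: eq_bigr => p _; rewrite IH mulr_sumr; apply: eq_bigr => ts _.
have ek c : nth None p.1 c = gamma_labels (rcons ts p) k c /\
    nth None p.2 c = delta_labels (rcons ts p) k c.
  by rewrite /gamma_labels /delta_labels nth_rcons size_tuple ltnn eqxx.
congr (_ * _); first exact: eq_double_row_weight.
apply: eq_config_weight; last exact: eq_above.
move=> j c jk _; rewrite /gamma_labels /delta_labels !nth_rcons size_tuple jk.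
by split.
Qed.
End Iterate.

(** * States and their horizontal labels *)

Section States.
Variables (F : fieldType) (q qh s nu t : F) (n L : nat).
Hypotheses (q0 : q != 0) (s0 : s != 0).
Variables (mu : 'I_n -> int) (sg : {perm scolor n}) (x : 'I_n -> F).
Hypothesis hsx : forall k, 1 - s * x k != 0.

Notation hT := {ffun 'I_n.*2 * 'I_L.+1 -> label n}.

Definition hlabel (h : hT) (r c : nat) : label n :=
  if (insub r : option 'I_n.*2, insub c : option 'I_L.+1) is (Some r', Some c')
  then h (r', c') else None.

Lemma hlabelE (h : hT) (r : 'I_n.*2) (c : 'I_L.+1) : hlabel h r c = h (r, c).
Proof. by rewrite /hlabel !valK. Qed.

(* [k] counts rows from the bottom. *)
Fixpoint vlabel (h : hT) (k c : nat) : cvec n :=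
  if k is k'.+1 then
    let r := (n.*2 - k)%N in
    if odd r then transfer (vlabel h k' c) (hlabel h r c.+1) (hlabel h r c)
    else transfer (vlabel h k' c) (hlabel h r c) (hlabel h r c.+1)
  else evec None.

Definition state_of (h : hT) : state n L :=
  (h, [ffun rc : 'I_n.*2.+1 * 'I_L => vlabel h (n.*2 - rc.1) rc.2]).

Lemma state_of_inj : injective state_of.
Proof. by move=> h h' /(congr1 fst). Qed.

Lemma ledgeE h (r : 'I_n.*2) (c : 'I_L) : ledge (state_of h) r c = hlabel h r c.+1.
Proof. by rewrite /ledge /hedge /= -hlabelE lift0. Qed.
Lemma redgeE h (r : 'I_n.*2) (c : 'I_L) : redge (state_of h) r c = hlabel h r c.
Proof. by rewrite /redge /hedge /= -hlabelE. Qed.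
Lemma bedgeE h (r : 'I_n.*2) (c : 'I_L) :
  bedge (state_of h) r c = vlabel h (n.*2 - r.+1) c.
Proof. by rewrite /bedge /vedge /= ffunE. Qed.
Lemma tedgeE h (r : 'I_n.*2) (c : 'I_L) :
  tedge (state_of h) r c = vlabel h (n.*2 - r) c.
Proof. by rewrite /tedge /vedge /= ffunE. Qed.

Lemma tedge_step h (r : 'I_n.*2) (c : 'I_L) :
  tedge (state_of h) r c =
  if odd r then
    transfer (bedge (state_of h) r c) (ledge (state_of h) r c) (redge (state_of h) r c)
  else
    transfer (bedge (state_of h) r c) (redge (state_of h) r c) (ledge (state_of h) r c).
Proof.
have hr := ltn_ord r.
rewrite tedgeE bedgeE ledgeE redgeE.
have -> : (n.*2 - r = (n.*2 - r.+1).+1)%N by lia.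
rewrite /=; have -> : (n.*2 - (n.*2 - r.+1).+1 = r)%N by lia.
by [].
Qed.

(** Induction upwards from the empty bottom edges: at a vertex of a state of nonzero weight,
    conservation fixes the top edge. Hence a sum over the states [state_of h] misses only zero
    terms. *)
Lemma state_determined st :
  admissible mu sg st -> state_weight q qh s nu t x st != 0 -> st = state_of st.1.
Proof.
move=> [_ _ b0 _] w0.
suff eqv (m : nat) (r : 'I_n.*2.+1) (c : 'I_L) :
    (n.*2 - r)%N = m -> vedge st r c = vedge (state_of st.1) r c.
  rewrite [LHS]surjective_pairing; congr pair.
  by apply/ffunP => -[r c]; exact: (eqv _ r c erefl).
elim: m r => [|m IH] r hr.
  have -> : r = ord_max.
    by apply/val_inj/eqP; rewrite /= eqn_leq -ltnS ltn_ord -subn_eq0 hr.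
  by rewrite b0 /vedge /= ffunE /= subnn.
have ltr : (r < n.*2)%N by rewrite -subn_gt0 hr.
have -> : r = widen_ord (leqnSn n.*2) (Ordinal ltr) by exact/val_inj.
have eqb : bedge st (Ordinal ltr) c = bedge (state_of st.1) (Ordinal ltr) c.
  by apply: IH; rewrite /= /bump leq0n add1n subnS hr.
have := state_weight_conserved (Ordinal ltr) c w0.
rewrite -![vedge _ (widen_ord _ (Ordinal ltr)) c]/(tedge _ (Ordinal ltr) c).
rewrite tedge_step -eqb.
by case: ifP => _ /conserved_transfer ->.
Qed.

Lemma partition_function_sum :
  partition_function q qh s nu t L mu sg x =
  \sum_(h : hT | `[< admissible mu sg (state_of h) >])
     state_weight q qh s nu t x (state_of h).
Proof.
rewrite /partition_function.
pose r := [seq state_of h | h <- enum hT & `[< admissible mu sg (state_of h) >]].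
rewrite (fsbigE r).
- rewrite big_map big_filter_cond big_enum_cond /=; apply: eq_bigl => h.
  by apply: andb_idr => /asboolP ?; rewrite inE.
- by rewrite (map_inj_uniq state_of_inj) filter_uniq ?enum_uniq.
- by move=> st /= /mapP[h]; rewrite mem_filter => /andP[/asboolP ? _] ->.
- move=> st adm; apply: contraNeq => w0; apply/mapP; exists st.1.
    by rewrite mem_filter mem_enum andbT; apply/asboolP; rewrite -state_determined.
  exact: state_determined.
Qed.

Definition param_at (k : nat) : F := if (insub k : option 'I_n) is Some i then x i
  else 0.
Definition color_at (k : nat) : label n :=
  if (insub k : option 'I_n) is Some i then Some (sg (inl i)) else None.
(** The condition on the top edges, as the innermost continuation of [double_rows]. *)
Definition top_indicator (Ks : seq (cvec n)) : F :=
  (Ks == mkseq (fun c => top_vec mu c.+1) L)%:R.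

Lemma param_atE (i : 'I_n) : param_at i = x i. Proof. by rewrite /param_at valK. Qed.
Lemma color_atE (i : 'I_n) : color_at i = Some (sg (inl i)). Proof. by rewrite
  /color_at valK. Qed.

Definition gamma_label h k c := hlabel h k.*2.+1 c.
Definition delta_label h k c := hlabel h k.*2 c.

(** [config_weight] counts the pairs that remain at the top while [vlabel] counts rows from the
    bottom, so the topmost [k] pairs stand on [vlabel h (n.*2 - k.*2)]. *)
Lemma config_weight_prod h k : (k <= n)%N ->
  config_weight q qh s nu t L param_at color_at top_indicator (gamma_label h)
    (delta_label h) k (vlabel h (n.*2 - k.*2)) =
  \prod_(j < k) double_row_weight q qh s nu t L param_at color_at (gamma_label h)
    (delta_label h) (vlabel h (n.*2 - j.*2.+2)) j *
  top_indicator (mkseq (vlabel h n.*2) L).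
Proof.
elim: k => [|k IH] kn; first by rewrite big_ord0 mul1r double0 subn0.
rewrite big_ord_recr /= doubleS [RHS]mulrAC -IH; last exact: ltnW.
rewrite [RHS]mulrC; congr (_ * _); apply: eq_config_weight => // c _.
have -> : (n.*2 - k.*2 = (n.*2 - k.*2.+2).+2)%N by lia.
rewrite /above_delta /above_gamma /=.
have -> : (n.*2 - (n.*2 - k.*2.+2).+2 = k.*2)%N by lia.
have -> : (n.*2 - (n.*2 - k.*2.+2).+1 = k.*2.+1)%N by lia.
by rewrite /= odd_double.
Qed.

Lemma double_row_weight_state h (j : 'I_n) :
  double_row_weight q qh s nu t L param_at color_at (gamma_label h) (delta_label h)
    (vlabel h (n.*2 - j.*2.+2)) j =
  (hedge (state_of h) (gamma_row j) ord_max == Some (sg (inl j)))%:R *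
  (hedge (state_of h) (delta_row j) ord_max == None)%:R *
  (Cweight qh nu t (x j)
       (hedge (state_of h) (gamma_row j) ord0) (hedge (state_of h) (delta_row j)
         ord0) *
     \prod_(c < L)
       (Lweight q s (x j)
          (bedge (state_of h) (gamma_row j) c) (ledge (state_of h) (gamma_row j) c)
          (tedge (state_of h) (gamma_row j) c) (redge (state_of h) (gamma_row j) c) *
        Mweight q s (x j)
          (bedge (state_of h) (delta_row j) c) (redge (state_of h) (delta_row j) c)
          (tedge (state_of h) (delta_row j) c) (ledge (state_of h) (delta_row j) c))).
Proof.
rewrite /double_row_weight /gamma_label /delta_label param_atE color_atE.
rewrite /hedge /= -!hlabelE [X in _ = _ * (_ * X)]big_split /= !mulrA.
congr (_ * _ * _); apply: eq_bigr => c _; rewrite tedge_step /= odd_double /=.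
  by rewrite LweightE // bedgeE ledgeE redgeE.
rewrite MweightE // ledgeE redgeE; congr (flow_weight _ _ _ _ _ _ _).
(* The bottom edge of a Delta vertex is the top edge of the Gamma vertex below it. *)
have := tedge_step h (gamma_row j) c.
by rewrite tedgeE bedgeE ledgeE redgeE /= odd_double /= bedgeE => ->.
Qed.

Lemma top_indicatorE h :
  top_indicator (mkseq (vlabel h n.*2) L) =
  `[< forall c : 'I_L, vedge (state_of h) ord0 c = top_vec mu c.+1 >]%:R.
Proof.
rewrite /top_indicator; congr (_%:R : F); congr nat_of_bool; apply/eqP/asboolP => [e
  c|e].
  rewrite /vedge /= ffunE /= subn0.
  by have := congr1 (fun s => nth (evec None) s c) e; rewrite !nth_mkseq.
apply: (@eq_from_nth _ (evec None)); rewrite !size_mkseq // => c cL.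
rewrite !nth_mkseq //; have := e (Ordinal cL).
by rewrite /vedge /= ffunE /= subn0.
Qed.

Lemma config_weight_state h :
  config_weight q qh s nu t L param_at color_at top_indicator (gamma_label h)
    (delta_label h) n (fun=> evec None) =
  `[< admissible mu sg (state_of h) >]%:R * state_weight q qh s nu t x (state_of h).
Proof.
have := config_weight_prod h (leqnn n); rewrite subnn => ->.
under eq_bigr => j _ do rewrite double_row_weight_state.
rewrite big_split -/(state_weight q qh s nu t x (state_of h)) top_indicatorE.
rewrite [X in X * _ * _]big_split /=.
rewrite mulrAC; congr (_ * _).
case: asboolP => [top|ntop]; last first.
  by rewrite mulr0n mulr0; case: asboolP => // -[_ _ _ /ntop].
rewrite mulr1n mulr1; case: asboolP => [[hd hg _ _]|nadm].
  rewrite !big1 ?mulr1 // => j _; first by rewrite hd eqxx.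
  by rewrite hg eqxx.
apply/eqP; apply: contra_notT nadm; rewrite mulf_eq0 negb_or.
have nz (b : bool) : (b%:R : F) != 0 -> b by case: b; rewrite ?eqxx.
move=> /andP[/prodf_neq0 hg /prodf_neq0 hd]; split => // [j|j|c].
- by apply/eqP/nz; exact: hd.
- by apply/eqP/nz; exact: hg.
- by rewrite /vedge /= ffunE /= subnn.
Qed.

Notation rowT := (L.+1.-tuple (label n)).

Theorem partition_function_double_rows :
  partition_function q qh s nu t L mu sg x =
  double_rows q qh s nu t param_at color_at top_indicator n (mkseq (fun=> evec None)
    L).
Proof.
rewrite double_rows_mkseq partition_function_sum big_mkcond.
(* An array of horizontal labels is cut into pairs of rows; [fwd] is bijective, being injective
   between sets of equal size. *)
pose fwd (h : hT) : n.-tuple (rowT * rowT) :=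
  [tuple ([tuple h (gamma_row j, c) | c < L.+1],
          [tuple h (delta_row j, c) | c < L.+1]) | j < n].
have fwd_nth h (j : nat) (c : nat) : (j < n)%N -> (c <= L)%N ->
    gamma_labels (fwd h) j c = gamma_label h j c /\ delta_labels (fwd h) j c =
      delta_label h j c.
  move=> jn cL; rewrite /gamma_labels /delta_labels.
  pose j' := Ordinal jn; pose c' : 'I_L.+1 := Ordinal (cL : (c < L.+1)%N).
  rewrite /fwd (nth_mktuple _ _ j') /= !(nth_mktuple _ _ c').
  by split; rewrite -hlabelE.
have fwd_bij : bijective fwd.
  apply: inj_card_bij => [h h' e|]; last first.
    rewrite card_tuple card_prod card_tuple card_ffun card_prod !card_ord.
    by rewrite -expnD addnn -expnM -doubleMl doubleMr mulnC.
  apply/ffunP => -[r c]; rewrite -!hlabelE.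
  have ltr : (r./2 < n)%N by rewrite ltn_half_double.
  have cL : (c <= L)%N by rewrite -ltnS.
  have [] := fwd_nth h _ _ ltr cL; have [] := fwd_nth h' _ _ ltr cL.
  rewrite e /gamma_label /delta_label => -> -> eg ed; rewrite -[nat_of_ord
    r]odd_double_half.
  by case: (odd r).
rewrite [RHS](reindex fwd) /=; last exact: onW_bij.
apply: eq_bigr => h _.
transitivity (config_weight q qh s nu t L param_at color_at top_indicator
  (gamma_label h) (delta_label h) n (fun=> evec None)).
  by rewrite config_weight_state; case: asboolP => _; rewrite ?mul1r ?mul0r.
by apply: eq_config_weight => // j c jn cL; have [-> ->] := fwd_nth h _ _ jn cL.
Qed.
End States.

(** * Extension to [1 - q x y = 0] *)

Section RegularFunctions.
Variables (F : numFieldType) (x0 : F).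
Implicit Types (f g : F -> F) (p r d : {poly F}).

(** A rational function without pole at [x0]. The values of [f] at the zeros of [r] are left free,
    since inverses may take their default value there. *)
Definition regular f := exists p r,
  r.[x0] != 0 /\ forall z, r.[z] != 0 -> f z * r.[z] = p.[z].

Lemma regular_const c : regular (fun=> c).
Proof. by exists c%:P, 1; split=> [|z _]; rewrite !hornerE ?oner_eq0. Qed.

Lemma regular_id : regular id.
Proof. by exists 'X, 1; split=> [|z _]; rewrite !hornerE ?oner_eq0. Qed.

Lemma regularD f g : regular f -> regular g -> regular (fun z => f z + g z).
Proof.
move=> [p [r [r0 hf]]] [p' [r' [r0' hg]]].
exists (p * r' + p' * r), (r * r'); split=> [|z]; first by rewrite hornerM mulf_neq0.
rewrite !hornerE mulf_eq0 negb_or => /andP[rz rz'].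
by rewrite -(hf _ rz) -(hg _ rz') /=; ring.
Qed.

Lemma regularM f g : regular f -> regular g -> regular (fun z => f z * g z).
Proof.
move=> [p [r [r0 hf]]] [p' [r' [r0' hg]]].
exists (p * p'), (r * r'); split=> [|z]; first by rewrite hornerM mulf_neq0.
rewrite !hornerE mulf_eq0 negb_or => /andP[rz rz'].
by rewrite -(hf _ rz) -(hg _ rz') /=; ring.
Qed.

Lemma regularN f : regular f -> regular (fun z => - f z).
Proof.
move=> [p [r [r0 hf]]]; exists (- p), r; split=> // z rz.
by rewrite hornerN -hf // mulNr.
Qed.

Lemma regularB f g : regular f -> regular g -> regular (fun z => f z - g z).
Proof. by move=> hf hg; apply: regularD => //; exact: regularN. Qed.

Lemma regularX f k : regular f -> regular (fun z => f z ^+ k).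
Proof.
move=> hf; elim: k => [|k IH]; first exact: regular_const.
have [p [r [r0 h]]] := regularM hf IH.
by exists p, r; split=> // z rz; rewrite exprS h.
Qed.

Lemma regular_sum (J : finType) (f : J -> F -> F) :
  (forall j, regular (f j)) -> regular (fun z => \sum_j f j z).
Proof.
move=> hf; have [p [r [r0 h]]] : regular (\sum_j f j).
  apply: (big_ind regular) => [|g h|j _]; [exact: regular_const | exact: regularD |
    exact: hf].
by exists p, r; split=> // z rz; rewrite -h // fct_sumE.
Qed.

Lemma regularV f : f x0 != 0 -> regular f -> regular (fun z => (f z)^-1).
Proof.
(* The inverse of [f] is [r / p]; the extra factor [r] restricts to the points where [f] is known to
   be [p / r]. *)
move=> fx0 [p [r [r0 hf]]]; exists (r * r), (p * r); split=> [|z].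
  by rewrite hornerM mulf_neq0 // -hf // mulf_neq0.
rewrite !hornerM mulf_eq0 negb_or => /andP[pz rz]; rewrite -(hf _ rz) in pz *.
have fz : f z != 0 by apply: contraNneq pz => ->; rewrite mul0r.
by rewrite -!mulrA mulKf.
Qed.

(** In characteristic 0 the points 0, 1, 2, ... are distinct, which gives too many roots for a
    nonzero polynomial. *)
Lemma poly_eq0_all p : (forall z, p.[z] = 0) -> p = 0.
Proof.
move=> hp; apply/eqP; apply: contraT => p0.
have := @max_poly_roots _ p (mkseq (fun k => k%:R) (size p)) p0.
rewrite size_mkseq ltnn => -> //; first by apply/allP => z _; rewrite rootE hp.
by apply/mkseq_uniqP => i j _ _ /eqP; rewrite eqr_nat => /eqP.
Qed.

(** The polynomial [p * (d * r)] vanishes at every point, so [p = 0]; as [r] does not vanish at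
    [x0], this reaches [x0] even if [d] vanishes there. *)
Lemma regular_eq0 f d : d != 0 -> regular f ->
  (forall z, d.[z] != 0 -> f z = 0) -> f x0 = 0.
Proof.
move=> d0 [p [r [r0 hf]]] f0.
have : p * (d * r) = 0.
  apply: poly_eq0_all => z; rewrite !hornerM.
  case: (eqVneq d.[z] 0) => [->|dz]; first by rewrite mul0r mulr0.
  case: (eqVneq r.[z] 0) => [->|rz]; first by rewrite !mulr0.
  by rewrite -hf // f0 // !mul0r.
have rn0 : r != 0 by apply: contraNneq r0 => ->; rewrite horner0.
move/eqP; rewrite !mulf_eq0 (negPf d0) (negPf rn0) !orbF => /eqP p0.
by have /eqP := hf _ r0; rewrite p0 horner0 mulf_eq0 (negPf r0) orbF => /eqP.
Qed.

Lemma regular_row_op (T : finType) (V : Type) (w : F -> V -> T -> T -> F)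
    (m : V -> T -> T -> V) Is a c (g : F -> seq V -> F) :
  (forall v (l e : T), regular (fun z => w z v l e)) ->
  (forall Ks, regular (fun z => g z Ks)) ->
  regular (fun z => row_op (w z) m Is a c (g z)).
Proof.
move=> hw; elim: Is a c g => [|v Is IH] a c g hg /=.
  case: (a == c); last exact: regular_const.
  exact: hg.
apply: regular_sum => e; apply: regularM; first exact: hw.
by apply: IH => Ks; exact: hg.
Qed.
End RegularFunctions.

Section Exchange.
Variables (F : numFieldType) (q qh s nu t : F) (n : nat).
Hypotheses (q0 : q != 0) (s0 : s != 0) (nu0 : nu != 0) (hqh : qh ^+ 2 = q).

Lemma regular_flow_weight x0 (rk : label n -> nat) I a c : 1 - s * x0 != 0 ->
  regular x0 (fun z => flow_weight q s rk z I a c).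
Proof.
move=> hx; rewrite /flow_weight /base_weight.
apply: regularM.
  apply: regularM; first exact: regular_const.
  apply: regularV => //; apply: regularB; first exact: regular_const.
  by apply: regularM; [exact: regular_const | exact: regular_id].
apply: regularM; first exact: regular_const.
case: (rk a < rk c)%N; [|case: (rk c < rk a)%N; first exact: regular_const].
  by apply: regularM; [apply: regularN; exact: regular_id | exact: regular_const].
by apply: regularB; [exact: regular_const | exact: regular_id].
Qed.

Lemma regular_Cweight x0 (a b : label n) : x0 != 0 ->
  1 - nu * t * (qh^-1 * x0^-1) != 0 -> 1 + nu^-1 * (qh^-1 * x0^-1) != 0 ->
  regular x0 (fun z => Cweight qh nu t z a b).
Proof.
move=> hx h1 h2.
have hV : regular x0 (fun z => qh^-1 * z^-1).
  by apply: regularM;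
    [exact: regular_const | apply: regularV => //; exact: regular_id].
have hp : regular x0 (fun z => phi nu t (qh^-1 * z^-1)).
  rewrite /phi; apply: regularM.
    by apply: regularB; [exact: regular_const | exact: regularX].
  apply: regularV; first by rewrite mulf_neq0.
  apply: regularM.
    apply: regularB; first exact: regular_const.
    by apply: regularM; first exact: regular_const.
  apply: regularD; first exact: regular_const.
  by apply: regularM; first exact: regular_const.
have htp : regular x0 (fun z => t * phi nu t (qh^-1 * z^-1)).
  by apply: regularM; first exact: regular_const.
rewrite /Cweight; case: a => [[]i|]; case: b => [[]j|]; try case: eqP => _;
  by do ?[exact: regular_const | exact: hp | exact: htp | apply: regularB].
Qed.

Lemma regular_double_row x0 (y : F -> F) a (g : F -> seq (cvec n) -> F) Is :
  (forall (rk : label n -> nat) I a c, regular x0 (fun z => flow_weight q s rk (y z)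
    I a c)) ->
  (forall a b : label n, regular x0 (fun z => Cweight qh nu t (y z) a b)) ->
  (forall Ks, regular x0 (fun z => g z Ks)) ->
  regular x0 (fun z => double_row q qh s nu t (y z) a (g z) Is).
Proof.
move=> hw hC hg; apply: regular_sum => c; apply: regular_row_op => // Ks.
apply: regular_sum => d; apply: regularM => //.
by apply: regular_row_op.
Qed.

Theorem double_row_exchange (x y : F) (a b : scolor n) (g : seq (cvec n) -> F) Is :
  ltl (Some a) (Some b) -> x != 0 -> y != 0 -> 1 - s * x != 0 ->
  1 - nu * t * (qh^-1 * x^-1) != 0 -> 1 + nu^-1 * (qh^-1 * x^-1) != 0 ->
  1 - nu * t * (qh^-1 * y^-1) != 0 -> 1 + nu^-1 * (qh^-1 * y^-1) != 0 ->
  let P := @double_row F q qh s nu t n in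
  q * (y - x) * q ^+ is_pos b * P y (Some a) (P x (Some b) g) Is +
  (1 - q) * y * q ^+ is_pos a * P y (Some b) (P x (Some a) g) Is =
  (y - q * x) * q ^+ is_pos a * P x (Some b) (P y (Some a) g) Is.
Proof.
move=> ab x0 y0 sx hx1 hx2 hy1 hy2 P; apply/eqP; rewrite -subr_eq0; apply/eqP.
have qh0 : qh != 0 by move: q0; rewrite -hqh expf_eq0.
pose f z := q * (y - z) * q ^+ is_pos b * P y (Some a) (P z (Some b) g) Is +
  (1 - q) * y * q ^+ is_pos a * P y (Some b) (P z (Some a) g) Is -
  (y - q * z) * q ^+ is_pos a * P z (Some b) (P y (Some a) g) Is.
pose d : {poly F} := 'X * (1 - (q * y) *: 'X) * ('X - (nu * t / qh)%:P) *
   ('X + (nu^-1 / qh)%:P).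
apply: (@regular_eq0 F x f d).
- rewrite !mulf_neq0 ?polyX_eq0 ?polyXsubC_eq0 //.
    apply/eqP => /(congr1 (fun p => p.[0])); rewrite !hornerE /=.
    by move/eqP; rewrite ?mulr0 ?subr0 oner_eq0.
  by rewrite -[_%:P]opprK -polyCN polyXsubC_eq0.
- have rc := regular_const x; have ri := regular_id x.
  have rP c (h : F -> seq (cvec n) -> F) Ks : (forall Ms, regular x (fun z => h z
    Ms)) ->
      regular x (fun z => P z c (h z) Ks).
    move=> hh; apply: (@regular_double_row x id) => // [rk I u v|u v].
      exact: regular_flow_weight.
    exact: regular_Cweight.
  have rPy c (h : F -> seq (cvec n) -> F) Ks : (forall Ms, regular x (fun z => h z
    Ms)) ->
      regular x (fun z => P y c (h z) Ks).
    by move=> hh; apply: (@regular_double_row x (fun=> y)).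
  apply: regularB; [apply: regularD|]; apply: regularM.
  + by apply: regularM => //; apply: regularM => //; apply: regularB.
  + by apply: (rPy _ (fun z => P z (Some b) g)) => Ks; apply: (rP _ (fun=> g)).
  + exact: rc.
  + by apply: (rPy _ (fun z => P z (Some a) g)) => Ks; apply: (rP _ (fun=> g)).
  + by apply: regularM => //; apply: regularB => //; apply: regularM.
  + by apply: (rP _ (fun=> P y (Some a) g)).
move=> z; rewrite /d !hornerE /= !mulf_eq0 !negb_or -!andbA => /and4P[z0 z1 z2 z3].
rewrite /f double_row_exchange_generic ?subrr //.
- by have -> : q * (z * y) = q * y * z by ring.
- have -> : 1 - nu * t * (qh^-1 * z^-1) = (z - nu * t / qh) / z by field; rewrite qh0
  z0.
  by rewrite mulf_neq0 ?invr_eq0.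
- have -> : 1 + nu^-1 * (qh^-1 * z^-1) = (z + nu^-1 / qh) / z.
    by field; rewrite ?qh0 ?nu0 ?z0.
  by rewrite mulf_neq0 ?invr_eq0.
Qed.
End Exchange.

(** * Propagation through the lower rows, and the theorem *)

Section Iteration.
Variables (F : fieldType) (q qh s nu t : F) (n : nat).
Implicit Types (xx yy : nat -> F) (aa bb : nat -> label n).
Let Z := @double_rows F q qh s nu t n.

Lemma double_row_linear x (a : label n) k1 k2 (g1 g2 : seq (cvec n) -> F) Is :
  double_row q qh s nu t x a (fun Ks => k1 * g1 Ks + k2 * g2 Ks) Is =
  k1 * double_row q qh s nu t x a g1 Is + k2 * double_row q qh s nu t x a g2 Is.
Proof.
rewrite !mulr_sumr -big_split; apply: eq_bigr => c _ /=.
rewrite /gamma_op -row_op_linear; apply: eq_row_op => Ks.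
rewrite !mulr_sumr -big_split; apply: eq_bigr => d _ /=.
by rewrite /delta_op row_op_linear; ring.
Qed.

Lemma eq_double_row x (a : label n) (g1 g2 : seq (cvec n) -> F) Is : g1 =1 g2 ->
  double_row q qh s nu t x a g1 Is = double_row q qh s nu t x a g2 Is.
Proof.
move=> e; apply: eq_bigr => c _; apply: eq_row_op => Ks.
by apply: eq_bigr => d _; congr (_ * _); apply: eq_row_op.
Qed.

Lemma eq_double_rows xx yy aa bb g k Is :
  (forall j, (j < k)%N -> xx j = yy j /\ aa j = bb j) ->
  Z xx aa g k Is = Z yy bb g k Is.
Proof.
elim: k Is => [|k IH] Is e //=.
have [-> ->] := e k (ltnSn k); apply: eq_double_row => Ks; apply: IH => j jk.
by apply: e; rewrite ltnS ltnW.
Qed.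

(** The pairs of index at least [m] have the same parameters and labels in all three terms, and each
    of them acts linearly. *)
Lemma double_rows_linear (xx1 xx2 xx3 : nat -> F) (aa1 aa2 aa3 : nat -> label n) g k1
  k2 m k :
  (m <= k)%N ->
  (forall j, (m <= j)%N -> xx2 j = xx1 j /\ aa2 j = aa1 j) ->
  (forall j, (m <= j)%N -> xx3 j = xx1 j /\ aa3 j = aa1 j) ->
  (forall Is, Z xx1 aa1 g m Is = k1 * Z xx2 aa2 g m Is + k2 * Z xx3 aa3 g m Is) ->
  forall Is, Z xx1 aa1 g k Is = k1 * Z xx2 aa2 g k Is + k2 * Z xx3 aa3 g k Is.
Proof.
move=> /subnKC <- e2 e3 em; elim: (k - m)%N => [|d IH] Is; first by rewrite addn0.
rewrite addnS /=; have [-> ->] := e2 _ (leq_addr d m).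
have [-> ->] := e3 _ (leq_addr d m).
by rewrite -double_row_linear; exact: eq_double_row.
Qed.
End Iteration.

Lemma exchange_relation_solve (F : fieldType) (q x y qa qb A B C : F) :
  q != 0 -> y - x != 0 -> qb != 0 ->
  q * (y - x) * qb * A + (1 - q) * y * qa * B = (y - q * x) * qa * C ->
  A = (q * qb)^-1 * ((q - 1) * y / (y - x) * qa) * B +
      (q * qb)^-1 * ((y - q * x) / (y - x) * qa) * C.
Proof.
move=> q0 yx qb0 E.
have k0 : q * (y - x) * qb != 0 by rewrite !mulf_neq0.
apply: (mulfI k0); rewrite -[LHS](addrK ((1 - q) * y * qa * B)) E; field.
by rewrite qb0 yx q0.
Qed.

Local Open Scope complex_scope.

Theorem theorem3p2 (R : realType) (n L : nat) (hn : (1 <= n)%N) (hL : (1 <= L)%N)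
    (q qh s nu t : R[i]) (x : 'I_n -> R[i])
    (sigma : {perm scolor n}) (mu : 'I_n -> int) (i i' : 'I_n)
    (hqh : qh ^+ 2 = q)
    (hq : q != 0) (hs : s != 0) (hnu : nu != 0)
    (hx : forall k, x k != 0)
    (hsx : forall k, 1 - s * x k != 0)
    (hphi1 : forall k, 1 - nu * t * (qh^-1 * (x k)^-1) != 0)
    (hphi2 : forall k, 1 + nu^-1 * (qh^-1 * (x k)^-1) != 0)
    (hsigma : sigma \in Bn n)
    (hmu : forall k, (1 <= `|mu k| <= L)%N)
    (hi : i' = i.+1 :> nat)
    (hxi : x i' - x i != 0)
    (hlt : ltl (Some (sigma (inl i))) (Some (sigma (inl i')))) :
  q ^+ (1 + is_pos (sigma (inl i'))) *
    partition_function q qh s nu t L mu (bmul sigma (btperm i i')) x =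
  (q - 1) * x i' / (x i' - x i) * q ^+ is_pos (sigma (inl i)) *
    partition_function q qh s nu t L mu sigma x +
  (x i' - q * x i) / (x i' - x i) * q ^+ is_pos (sigma (inl i)) *
    partition_function q qh s nu t L mu sigma (x \o tperm i i').
Proof.
set a := sigma (inl i); set b := sigma (inl i'); set c := q ^+ (1 + is_pos b).
have c0 : c != 0 by rewrite expf_neq0.
rewrite !partition_function_double_rows //; last by move=> k /=; exact: hsx.
have ii' : i' != i by rewrite -val_eqE /= hi gtn_eqF.
have bti : btperm i i' (inl i) = inl i' by rewrite permM tpermL tpermD.
have bti' : btperm i i' (inl i') = inl i by rewrite permM tpermR tpermD.
have btD k : k != i -> k != i' -> btperm i i' (inl k) = inl k.
  by move=> ki ki'; rewrite permM !tpermD // eq_sym.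
pose k1 := c^-1 * ((q - 1) * x i' / (x i' - x i) * q ^+ is_pos a).
pose k2 := c^-1 * ((x i' - q * x i) / (x i' - x i) * q ^+ is_pos a).
(* Outside the positions [i] and [i.+1], neither the transposition nor the swap of the parameters
   changes anything. *)
have away j (hj : (j < i)%N || (i.+2 <= j)%N) :
    param_at (x \o tperm i i') j = param_at x j /\
    color_at (bmul sigma (btperm i i')) j = color_at sigma j.
  rewrite /param_at /color_at; case: insubP => //= k _ kj.
  have ki : k != i by rewrite -val_eqE /= kj; lia.
  have ki' : k != i' by rewrite -val_eqE /= kj hi; lia.
  by rewrite tpermD 1?eq_sym // permM btD.
suff E Is : double_rows q qh s nu t (param_at x) (color_at (bmul sigma (btperm i
  i'))) (top_indicator _ L mu) n Is =
    k1 * double_rows q qh s nu t (param_at x) (color_at sigma) (top_indicator _ L mu)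
      n Is +
    k2 * double_rows q qh s nu t (param_at (x \o tperm i i')) (color_at sigma)
      (top_indicator _ L mu) n Is.
  by rewrite E /k1 /k2; move: (double_rows _ _ _ _ _ _ _ _ _ _) => ?; field; rewrite
    c0 hxi.
have i2n : (i.+2 <= n)%N by rewrite -hi.
(* The exchanged pairs have the indices [i] and [i.+1], so it suffices to treat the topmost [i.+2]
   pairs. *)
apply: (@double_rows_linear _ _ _ _ _ _ _ _ _ _ _ _ _ _ _ _ i.+2) => //.
- by move=> j ij; have [_ ->] := away j (introT orP (or_intror ij)).
- by move=> j ij; have [-> ->] := away j (introT orP (or_intror ij)).
move=> Js /=.
have [ix iax] := (param_atE x i, color_atE sigma i).
have := param_atE x i'; have := color_atE sigma i'; rewrite hi => ia' ix'.
have ax : param_at (x \o tperm i i') i = x i' by rewrite param_atE /= tpermL.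
have ax' : param_at (x \o tperm i i') i.+1 = x i by rewrite -hi param_atE /= tpermR.
have aa : color_at (bmul sigma (btperm i i')) i = Some b by rewrite color_atE permM
  bti.
have aa' : color_at (bmul sigma (btperm i i')) i.+1 = Some a by rewrite -hi color_atE
  permM bti'.
rewrite ix iax ix' ia' ax ax' aa aa' -/a -/b.
(* The pairs above the two exchanged ones, common to the three terms. *)
pose g := double_rows q qh s nu t (param_at x) (color_at sigma) (top_indicator _ L
  mu) i.
have eA : double_row q qh s nu t (x i') (Some a) (double_row q qh s nu t (x i) (Some
  b)
      (double_rows q qh s nu t (param_at x) (color_at (bmul sigma (btperm i i')))
        (top_indicator _ L mu) i)) Js =
    double_row q qh s nu t (x i') (Some a) (double_row q qh s nu t (x i) (Some b) g)
      Js.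
  apply: eq_double_row => Ks; apply: eq_double_row => Ms; apply: eq_double_rows => j
    ij.
  by have [_ ->] := away j (introT orP (or_introl ij)).
have eC : double_row q qh s nu t (x i) (Some b) (double_row q qh s nu t (x i') (Some
  a)
      (double_rows q qh s nu t (param_at (x \o tperm i i')) (color_at sigma)
        (top_indicator _ L mu) i)) Js =
    double_row q qh s nu t (x i) (Some b) (double_row q qh s nu t (x i') (Some a) g)
      Js.
  apply: eq_double_row => Ks; apply: eq_double_row => Ms; apply: eq_double_rows => j
    ij.
  by have [-> _] := away j (introT orP (or_introl ij)).
rewrite eA eC -/g.
(* With [x := x i], [y := x i'] and [P] as in [double_row_exchange], the operators [P y a (P x b)],
   [P y b (P x a)] and [P x b (P y a)] belong to [bmul sigma (btperm i i')], to [sigma], and to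
   [sigma] with swapped parameters. *)
have := @double_row_exchange _ q qh s nu t n hq hs hnu hqh (x i) (x i') a b g Js hlt.
move=> /(_ (hx i) (hx i') (hsx i) (hphi1 i) (hphi2 i) (hphi1 i') (hphi2 i')) /= E.
have qb0 : q ^+ is_pos b != 0 by rewrite expf_neq0.
by rewrite /k1 /k2 /c exprD expr1; exact: (exchange_relation_solve hq hxi qb0 E).
Qed.
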